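(* Let $T$ be a complete affine theory which has a first order model. Then for every $n\ge 1$, the type space $S_n(T)$ is a Bauer simplex.
   Context: Affine continuous logic: A Lipschitz language $L$ consists of constant, function and relation symbols together with a metric symbol $d$, each function/relation symbol carrying a Lipschitz constant. An $L$-structure is a complete metric space $(M,d)$ with $d\le1$, with Lipschitz interpretations of function symbols $M^n\to M$ and relation symbols $M^n\to[0,1]$. Affine formulas are built from $1$ and atomic formulas using only $r\cdot\phi$ ($r\in\mathbb R$), $\phi+\psi$, $\inf_x$, $\sup_x$. A complete theory $T$ is one such that for every sentence $\phi$ there is a unique $r$ with $T\models\phi=r$. Let $\mathbb D_n$ be the normed space of affine formulas in $n$ free variables modulo $T$-equivalence, with $\|\phi\|=\sup_{\bar a}|\phi^M(\bar a)|$ for $M\models T$. An $n$-type of $T$ is identified with a positive linear functional $p$ on $\mathbb D_n$ with $p(1)=1$ ($p(\phi)$ being the value of $\phi$ forced by the type); $S_n(T)$, the set of $n$-types, is a weak$^*$-compact convex subset of the dual $\mathbb D_n^*$ (the weak$^*$ topology is the logic topology). A first order model is an $L$-structure in which $d$ is the discrete $\{0,1\}$-metric and all relations are $\{0,1\}$-valued. A compact convex set $K$ in a locally convex space is a Bauer simplex if its set of extreme points $\mathrm{Ext}(K)$ is closed and every $x\in K$ is the barycenter of a unique regular Borel probability measure $\mu$ on $K$ concentrated on $\mathrm{Ext}(K)$; here $\mu$ has barycenter $x$ if $h(x)=\int h\,d\mu$ for every continuous affine $h:K\to\mathbb R$. *)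

(* Defs.v *)
From HB Require Import structures.
From mathcomp Require Import all_boot all_order all_algebra.
From mathcomp Require Import all_classical all_reals all_analysis.

Set Implicit Arguments.
Unset Strict Implicit.
Unset Printing Implicit Defensive.

Import Order.TTheory GRing.Theory Num.Theory.
Import numFieldNormedType.Exports.
Local Open Scope classical_set_scope.
Local Open Scope ring_scope.

(* Lipschitz languages.  Constant symbols are the 0-ary function       *)
(* symbols; the metric symbol d is built in.  Every function/relation  *)
(* symbol carries a Lipschitz constant.                                *)
Record language (R : realType) := Language {
  fsym : Type;
  rsym : Type;
  farity : fsym -> nat;
  rarity : rsym -> nat;
  flip : fsym -> R;
  rlip : rsym -> R }.

Definition maxdist (R : realType) (M : Type) (d : M -> M -> R) (k : nat)
  (a b : 'I_k -> M) : R := \big[Num.max/0]_(i < k) d (a i) (b i).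

Definition cauchy_seq (R : realType) (M : Type) (d : M -> M -> R)
  (u : nat -> M) : Prop :=
  forall e : R, 0 < e -> exists N : nat,
    forall m k : nat, (N <= m)%N -> (N <= k)%N -> d (u m) (u k) < e.

Definition converges_to (R : realType) (M : Type) (d : M -> M -> R)
  (u : nat -> M) (x : M) : Prop :=
  forall e : R, 0 < e -> exists N : nat, forall m : nat, (N <= m)%N -> d (u m) x < e.

Record structure (R : realType) (L : language R) := Structure {
  carrier : Type;
  s_point : carrier;
  dist : carrier -> carrier -> R;
  dist_ge0 : forall x y, 0 <= dist x y;
  dist_le1 : forall x y, dist x y <= 1;
  dist_sep : forall x y, dist x y = 0 <-> x = y;
  dist_sym : forall x y, dist x y = dist y x;
  dist_tri : forall x y z, dist x z <= dist x y + dist y z;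
  dist_complete : forall u : nat -> carrier, cauchy_seq dist u ->
    exists x, converges_to dist u x;
  finterp : forall f : fsym L, ('I_(farity f) -> carrier) -> carrier;
  rinterp : forall r : rsym L, ('I_(rarity r) -> carrier) -> R;
  finterp_lip : forall f a b,
    dist (@finterp f a) (@finterp f b) <= flip f * maxdist dist a b;
  rinterp_range : forall r a, 0 <= @rinterp r a <= 1;
  rinterp_lip : forall r a b,
    `|@rinterp r a - @rinterp r b| <= rlip r * maxdist dist a b }.

(* Terms and affine formulas in the free variables 0, ..., n-1.        *)
(* In [FInf φ] / [FSup φ] with φ : formula n.+1 the quantified         *)
(* variable is the last one (index n).                                  *)
Inductive term (R : realType) (L : language R) (n : nat) : Type :=
| TVar : 'I_n -> term L n
| TApp : forall f : fsym L, ('I_(farity f) -> term L n) -> term L n.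

Inductive formula (R : realType) (L : language R) : nat -> Type :=
| FOne : forall n, formula L n
| FRel : forall n (r : rsym L), ('I_(rarity r) -> term L n) -> formula L n
| FDist : forall n, term L n -> term L n -> formula L n
| FScale : forall n, R -> formula L n -> formula L n
| FAdd : forall n, formula L n -> formula L n -> formula L n
| FInf : forall n, formula L n.+1 -> formula L n
| FSup : forall n, formula L n.+1 -> formula L n.

Section Semantics.
Variables (R : realType) (L : language R) (M : structure L).

Fixpoint teval (n : nat) (a : 'I_n -> carrier M) (t : term L n) : carrier M :=
  match t with
  | TVar i => a i
  | TApp f ts => @finterp _ _ M f (fun i => teval a (ts i))
  end.

Definition ext_env (n : nat) (a : 'I_n -> carrier M) (x : carrier M) :
  'I_n.+1 -> carrier M :=
  fun i => match unlift ord_max i with Some j => a j | None => x end.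

Fixpoint feval (n : nat) (phi : formula L n) : ('I_n -> carrier M) -> R :=
  match phi with
  | FOne _ => fun _ => 1
  | FRel _ r ts => fun a => @rinterp _ _ M r (fun i => teval a (ts i))
  | FDist _ t s => fun a => dist (teval a t) (teval a s)
  | FScale _ c psi => fun a => c * feval psi a
  | FAdd _ psi chi => fun a => feval psi a + feval chi a
  | FInf _ psi => fun a => inf (range (fun x => feval psi (ext_env a x)))
  | FSup _ psi => fun a => sup (range (fun x => feval psi (ext_env a x)))
  end.

End Semantics.

Arguments teval {R L} M {n}.
Arguments feval {R L} M {n}.
Arguments ext_env {R L M n}.

(* Theories: sets of affine conditions [φ <= 0] for sentences φ.        *)
Definition theory (R : realType) (L : language R) := set (formula L 0).

Definition models (R : realType) (L : language R) (M : structure L)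
  (T : theory L) : Prop :=
  forall phi, T phi -> forall a : 'I_0 -> carrier M, feval M phi a <= 0.

Definition entails_eq (R : realType) (L : language R) (T : theory L)
  (phi : formula L 0) (r : R) : Prop :=
  forall M : structure L, models M T -> forall a, feval M phi a = r.

Definition complete_theory (R : realType) (L : language R) (T : theory L) : Prop :=
  forall phi : formula L 0, exists! r : R, entails_eq T phi r.

Definition first_order_structure (R : realType) (L : language R)
  (M : structure L) : Prop :=
  (forall x y : carrier M, dist x y = 0 \/ dist x y = 1) /\
  (forall (r : rsym L) (a : 'I_(rarity r) -> carrier M),
      @rinterp _ _ M r a = 0 \/ @rinterp _ _ M r a = 1).

Definition has_first_order_model (R : realType) (L : language R)
  (T : theory L) : Prop :=
  exists M : structure L, models M T /\ first_order_structure M.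

Definition T_equiv (R : realType) (L : language R) (T : theory L) (n : nat)
  (phi psi : formula L n) : Prop :=
  forall M : structure L, models M T -> forall a, feval M phi a = feval M psi a.

Definition T_nonneg (R : realType) (L : language R) (T : theory L) (n : nat)
  (phi : formula L n) : Prop :=
  forall M : structure L, models M T -> forall a, 0 <= feval M phi a.

(* a functional on D_n, represented on representatives *)
Definition is_type (R : realType) (L : language R) (T : theory L) (n : nat)
  (p : formula L n -> R) : Prop :=
  [/\ (forall phi psi, T_equiv T phi psi -> p phi = p psi),
      (forall phi psi, p (FAdd phi psi) = p phi + p psi),
      (forall c phi, p (FScale c phi) = c * p phi),
      (forall phi, T_nonneg T phi -> 0 <= p phi) &
      p (FOne L n) = 1].

(* D_n^* with its weak* topology, as pointwise-convergence topology on
   functions formula L n -> R *)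
Definition dual_space (R : realType) (L : language R) (n : nat) :=
  {ptws formula L n -> R}.

Definition type_space (R : realType) (L : language R) (T : theory L) (n : nat) :
  set (dual_space L n) := [set p | is_type T p].

Arguments type_space {R L} T n.

Section Bauer.
Variables (R : realType) (I : Type).
Local Notation X := {ptws I -> R}.

Definition cvx (t : R) (x y : X) : X := fun i => t * x i + (1 - t) * y i.

Definition convex_set (K : set X) : Prop :=
  forall x y t, K x -> K y -> 0 <= t <= 1 -> K (cvx t x y).

Definition extreme_points (K : set X) : set X :=
  [set x | K x /\ forall y z t, K y -> K z -> 0 < t < 1 ->
             x = cvx t y z -> y = x /\ z = x].

Definition affine_on (K : set X) (h : X -> R) : Prop :=
  forall x y t, K x -> K y -> 0 <= t <= 1 ->
    h (cvx t x y) = t * h x + (1 - t) * h y.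

Definition borelX := g_sigma_algebraType (open : set (set X)).

Definition regular_measure (mu : probability borelX R) : Prop :=
  forall B : set borelX, measurable B ->
    mu B = ereal_sup [set mu C | C in [set C : set X | compact C /\ C `<=` B]]
    /\ mu B = ereal_inf [set mu U | U in [set U : set X | open U /\ B `<=` U]].

Definition barycenter (K : set X) (mu : probability borelX R) (x : X) : Prop :=
  forall h : X -> R, {within K, continuous h} -> affine_on K h ->
    (h x)%:E = (\int[mu]_(y in (K : set borelX)) (h y)%:E)%E.

Definition representing (K : set X) (x : X) (mu : probability borelX R) : Prop :=
  [/\ regular_measure mu, mu (extreme_points K : set borelX) = 1%E &
      barycenter K mu x].

Definition bauer_simplex (K : set X) : Prop :=
  [/\ compact K, convex_set K, closed (extreme_points K) &
      forall x, K x -> exists mu, representing K x mu /\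
        forall nu, representing K x nu ->
          forall B : set borelX, measurable B -> nu B = mu B].

End Bauer.

(* Main.v *)
Require Import Defs.
From HB Require Import structures.
From mathcomp Require Import all_boot all_order all_algebra.
From mathcomp Require Import all_classical all_reals all_analysis.
From mathcomp Require Import measurable_realfun.
From mathcomp Require Import ring lra.

(** A formula is nonnegative in every model of [T] as soon as it is so in the
    first order model [M], hence the types are the states of the space [D] of
    functions on [M^n] defined by affine formulas, all finite-valued.  Writing
    [e] for the indicator of equality and weighing distances suitably,
      sup_w (c f(w) - d(w,x1) - d(w,x2) - 2 d(w,x3)) + d(x1,x3) + d(x2,x3)
        = c (f(x3) + e(x1,x2) max(0, f(x1) - f(x3)))      (c small),
    so [D] contains [e(x1,x2) (f(x1) - f(x3))]; differences and suprema then give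
    [e(u,v) f] for all [f] in [D], and
    [max(f,g) = sup_w (e(w,x) (f - g) + g)] when [M] has two points.
    Thus [D] is the span of a Boolean algebra of subsets of [M^n], states are
    finitely additive probabilities on it, and the extreme states are the
    two-valued ones.  These form a closed set; a state extends to a unique regular
    Borel measure on it, by Caratheodory's method applied to inner approximation
    of open sets by clopen ones. *)

Set Implicit Arguments.
Unset Strict Implicit.
Unset Printing Implicit Defensive.

Import Order.TTheory GRing.Theory Num.Theory.
Import numFieldNormedType.Exports.
Local Open Scope classical_set_scope.
Local Open Scope ring_scope.

(** * Definable functions of a first order structure *)

Section ExtremaOfSets.
Variable R : realType.

Lemma finite_set_max (A : set R) : finite_set A -> A !=set0 ->
  exists2 m, A m & forall x, A x -> x <= m.
Proof.
move=> /finite_seqP[s ->]; elim: s => [|y s IH]; first by case.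
move=> _; have [[z sz]|/set0P/negP/negbNE/eqP s0] := pselect ([set` s] !=set0).
  have [m sm mP] := IH (ex_intro _ z sz).
  have [ym|my] := leP y m.
    by exists m => [|x]; rewrite /= inE ?sm ?orbT// => /predU1P[->//|/mP].
  exists y => [|x]; rewrite /= inE ?eqxx// => /predU1P[->//|/mP xm].
  exact: le_trans xm (ltW my).
exists y => [|x]; rewrite /= inE ?eqxx// => /predU1P[->//|sx].
by have : [set` s] x := sx; rewrite s0.
Qed.

Lemma finite_set_min (A : set R) : finite_set A -> A !=set0 ->
  exists2 m, A m & forall x, A x -> m <= x.
Proof.
move=> fA [a Aa]; have := @finite_set_max (-%R @` A).
case=> [||_ [m Am <-] mP]; first exact: finite_image.
- by exists (- a), a.
- by exists m => // x Ax; rewrite -lerN2; apply: mP; exists x.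
Qed.

Lemma sup_max (A : set R) m : A m -> (forall x, A x -> x <= m) -> sup A = m.
Proof.
move=> Am mP; apply/eqP; rewrite eq_le; apply/andP; split.
  by apply: ge_sup; [exists m|move=> x /mP].
by apply: ub_le_sup => //; exists m => x /mP.
Qed.

Lemma inf_min (A : set R) m : A m -> (forall x, A x -> m <= x) -> inf A = m.
Proof.
move=> Am mP; apply/eqP; rewrite eq_le; apply/andP; split.
  by apply: ge_inf => //; exists m => x /mP.
by apply: lb_le_inf; [exists m|move=> x /mP].
Qed.

End ExtremaOfSets.

(** * Environments and renaming of variables *)

Section Environments.
Variables (R : realType) (L : language R) (M : structure L).

Lemma ext_env_max n (a : 'I_n -> carrier M) x : ext_env a x ord_max = x.
Proof. by rewrite /ext_env unlift_none. Qed.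

Lemma ext_env_lift n (a : 'I_n -> carrier M) x i :
  ext_env a x (lift ord_max i) = a i.
Proof. by rewrite /ext_env liftK. Qed.

Lemma ext_env_eta n (b : 'I_n.+1 -> carrier M) :
  ext_env (b \o lift ord_max) (b ord_max) = b.
Proof.
apply/funext => i; have [j ->|->] := unliftP ord_max i.
  by rewrite ext_env_lift.
by rewrite ext_env_max.
Qed.

(** The renaming under a quantifier: the bound variable is the last one, so [ord_max] stays fixed
    and [s] acts on the others. *)
Definition ren_lift n m (s : 'I_n -> 'I_m) : 'I_n.+1 -> 'I_m.+1 :=
  fun i => if unlift ord_max i is Some j then lift ord_max (s j) else ord_max.

Lemma ext_env_ren n m (s : 'I_n -> 'I_m) (a : 'I_m -> carrier M) x :
  ext_env a x \o ren_lift s = ext_env (a \o s) x.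
Proof.
apply/funext => i; rewrite /ren_lift /=; have [j ->|->] := unliftP ord_max i.
  by rewrite !ext_env_lift.
by rewrite !ext_env_max.
Qed.

End Environments.

Section Renaming.
Variables (R : realType) (L : language R).

Fixpoint trename n m (s : 'I_n -> 'I_m) (t : term L n) : term L m :=
  match t with
  | TVar i => TVar L (s i)
  | TApp f ts => TApp (fun i => trename s (ts i))
  end.

(** The target arity and the renaming are taken after the formula because both change on passing
    under a quantifier. *)
Fixpoint frename n (phi : formula L n) : forall m, ('I_n -> 'I_m) -> formula L m :=
  match phi with
  | FOne _ => fun m s => FOne L m
  | FRel _ r ts => fun m s => FRel (fun i => trename s (ts i))
  | FDist _ t u => fun m s => FDist (trename s t) (trename s u)
  | FScale _ c psi => fun m s => FScale c (frename psi s)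
  | FAdd _ psi chi => fun m s => FAdd (frename psi s) (frename chi s)
  | FInf _ psi => fun m s => FInf (frename psi (ren_lift s))
  | FSup _ psi => fun m s => FSup (frename psi (ren_lift s))
  end.

Lemma teval_rename (M : structure L) n m (s : 'I_n -> 'I_m) a (t : term L n) :
  teval M a (trename s t) = teval M (a \o s) t.
Proof. by elim: t => [//|f ts IH] /=; congr finterp; apply/funext => i. Qed.

Lemma feval_rename (M : structure L) n (phi : formula L n) m
    (s : 'I_n -> 'I_m) a :
  feval M (frename phi s) a = feval M phi (a \o s).
Proof.
elim: phi m s a => {n} /=.
- by [].
- by move=> n r ts m s a; congr rinterp; apply/funext => i; exact: teval_rename.
- by move=> n t u m s a; rewrite !teval_rename.
- by move=> n c psi IH m s a; rewrite IH.
- by move=> n psi IHpsi chi IHchi m s a; rewrite IHpsi IHchi.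
- move=> n psi IH m s a; congr inf; apply/seteqP; split=> _ [x _ <-];
    by exists x => //; rewrite IH ext_env_ren.
- move=> n psi IH m s a; congr sup; apply/seteqP; split=> _ [x _ <-];
    by exists x => //; rewrite IH ext_env_ren.
Qed.

End Renaming.

(** * Bounded values, and transfer from one model to all models of a complete theory *)

Section Bounds.
Variables (R : realType) (L : language R) (M : structure L).

(** Boundedness makes every [inf] and [sup] in the semantics a genuine one. A quantified formula
    keeps the bound of its body. *)
Lemma feval_bounded n (phi : formula L n) :
  exists B : R, forall a, `|feval M phi a| <= B.
Proof.
elim: phi => {n} /=.
- by move=> n; exists 1 => a; rewrite normr1.
- move=> n r ts; exists 1 => a.
  have /andP[r0 r1] := rinterp_range (fun i => teval M a (ts i)).
  by rewrite ger0_norm.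
- by move=> n t u; exists 1 => a; rewrite ger0_norm ?dist_le1 ?dist_ge0.
- by move=> n c psi [B BP]; exists (`|c| * B) => a; rewrite normrM ler_wpM2l.
- move=> n psi [B BP] chi [C CP]; exists (B + C) => a.
  by rewrite (le_trans (ler_normD _ _))// lerD.
- move=> n psi [B BP]; exists B => a; have x0 := s_point M.
  have BPx x : - B <= feval M psi (ext_env a x) <= B by rewrite -ler_norml.
  rewrite ler_norml lb_le_inf ?andTb; last 2 first.
  + by exists (feval M psi (ext_env a x0)), x0.
  + by move=> _ [x _ <-]; have /andP[] := BPx x.
  have /andP[_] := BPx x0; apply: le_trans; apply: ge_inf; last by exists x0.
  by exists (- B) => _ [x _ <-]; have /andP[] := BPx x.
- move=> n psi [B BP]; exists B => a; have x0 := s_point M.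
  have BPx x : - B <= feval M psi (ext_env a x) <= B by rewrite -ler_norml.
  rewrite ler_norml ge_sup ?andbT; last 2 first.
  + by exists (feval M psi (ext_env a x0)), x0.
  + by move=> _ [x _ <-]; have /andP[] := BPx x.
  have /andP[+ _] := BPx x0; move/le_trans; apply; apply: ub_le_sup; last by exists x0.
  by exists B => _ [x _ <-]; have /andP[] := BPx x.
Qed.

(** Used to close a formula one variable at a time; the bound on [phi] makes the infimum a lower
    bound of the values. *)
Lemma FInf_nonneg n (phi : formula L n.+1) :
  (forall a, 0 <= feval M phi a) <-> (forall a, 0 <= feval M (FInf phi) a).
Proof.
split=> [phi0 a|phi0 b] /=.
  apply: lb_le_inf => [|_ [x _ <-]//].
  by exists (feval M phi (ext_env a (s_point M))), (s_point M).
have [B BP] := feval_bounded phi.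
rewrite -(ext_env_eta b); apply: le_trans (phi0 (b \o lift ord_max)) _ => /=.
apply: ge_inf; last by exists (b ord_max).
by exists (- B) => _ [x _ <-]; have := BP (ext_env (b \o lift ord_max) x);
  rewrite ler_norml => /andP[].
Qed.

End Bounds.

(** Infima over all variables turn nonnegativity of [phi] into that of a sentence, whose value is
    the same in all models by completeness. *)
Lemma complete_nonneg (R : realType) (L : language R) (T : theory L)
    (M : structure L) : complete_theory T -> models M T ->
  forall n (phi : formula L n),
    (forall a, 0 <= feval M phi a) <-> T_nonneg T phi.
Proof.
move=> cT MT n phi; split=> [|]; last by move/(_ _ MT).
elim: n phi => [|n IH] phi phi0 N NT.
  have [r [rP _]] := cT phi => a.
  (* Sentences are evaluated in the empty environment, which [a'] provides for [M]. *)
  have a' : 'I_0 -> carrier M by case.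
  by rewrite (rP _ NT) -(rP _ MT a').
by apply/FInf_nonneg; apply: IH => //; apply/FInf_nonneg.
Qed.

Lemma complete_equiv (R : realType) (L : language R) (T : theory L)
    (M : structure L) : complete_theory T -> models M T ->
  forall n (phi psi : formula L n),
    feval M phi =1 feval M psi <-> T_equiv T phi psi.
Proof.
move=> cT MT n phi psi; split=> [E|]; last by move/(_ _ MT).
have H (chi xi : formula L n) : feval M chi =1 feval M xi ->
    T_nonneg T (FAdd chi (FScale (-1) xi)).
  move=> Ecx; apply/(complete_nonneg cT MT) => a /=.
  by rewrite Ecx mulN1r subrr.
move=> N NT a; apply/eqP; rewrite eq_le -subr_ge0 -[X in _ && X]subr_ge0.
(* Equality is nonnegativity of both differences. Here [fsym] is symmetry of pointwise equality, not
   a set of function symbols. *)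
have /(_ N NT a) /= := H _ _ E; have /(_ N NT a) /= := H _ _ (fsym E).
by rewrite !mulN1r => -> ->.
Qed.

(** * Functions on [M^n] defined by affine formulas *)

Section Definable.
Variables (R : realType) (L : language R) (M : structure L).
Hypothesis foM : first_order_structure M.

Definition definable n (f : ('I_n -> carrier M) -> R) : Prop :=
  exists phi : formula L n, feval M phi =1 f.

(** Atomic formulas take the values 0 and 1 only. Over a finite range infima and suprema are
    attained, so a quantifier creates no new value. *)
Lemma finite_range_feval n (phi : formula L n) :
  finite_set (range (feval M phi)).
Proof.
elim: phi => {n} /=.
- move=> n; apply: (@sub_finite_set _ _ [set 1]); last exact: finite_set1.
  by move=> _ [a _ <-].
- move=> n r ts; apply: (@sub_finite_set _ _ [set 0; 1]).
    by move=> _ [a _ <-] /=; case: (foM.2 r (fun i => teval M a (ts i))) => ->; [left|right].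
  exact: finite_set2.
- move=> n t u; apply: (@sub_finite_set _ _ [set 0; 1]).
    by move=> _ [a _ <-] /=; case: (foM.1 (teval M a t) (teval M a u)) => ->; [left|right].
  exact: finite_set2.
- move=> n c psi IH; apply: (@sub_finite_set _ _ ( *%R c @` range (feval M psi))).
    by move=> _ [a _ <-]; exists (feval M psi a) => //; exists a.
  exact: finite_image.
- move=> n psi IHpsi chi IHchi.
  apply: (@sub_finite_set _ _ ((fun p => p.1 + p.2) @`
    (range (feval M psi) `*` range (feval M chi)))).
    by move=> _ [a _ <-]; exists (feval M psi a, feval M chi a).
  by apply: finite_image; apply: finite_setX.
- move=> n psi IH; apply: sub_finite_set (IH) => _ [a _ <-].
  have [||_ [x _ <-] mP] := @finite_set_min R (range (fun x => feval M psi (ext_env a x))).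
  + by apply: sub_finite_set (IH) => _ [x _ <-]; exists (ext_env a x).
  + by exists (feval M psi (ext_env a (s_point M))), (s_point M).
  by exists (ext_env a x) => //; rewrite (@inf_min _ _ (feval M psi (ext_env a x)))//; exists x.
- move=> n psi IH; apply: sub_finite_set (IH) => _ [a _ <-].
  have [||_ [x _ <-] mP] := @finite_set_max R (range (fun x => feval M psi (ext_env a x))).
  + by apply: sub_finite_set (IH) => _ [x _ <-]; exists (ext_env a x).
  + by exists (feval M psi (ext_env a (s_point M))), (s_point M).
  by exists (ext_env a x) => //; rewrite (@sup_max _ _ (feval M psi (ext_env a x)))//; exists x.
Qed.

Lemma definable_ext n (f g : ('I_n -> carrier M) -> R) :
  definable f -> f =1 g -> definable g.
Proof. by move=> [phi Ef] Efg; exists phi => a; rewrite Ef Efg. Qed.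

Lemma definable_finite n (f : ('I_n -> carrier M) -> R) :
  definable f -> finite_set (range f).
Proof. by move=> [phi /funext <-]; exact: finite_range_feval. Qed.

Lemma definableZ n c (f : ('I_n -> carrier M) -> R) :
  definable f -> definable (fun a => c * f a).
Proof. by move=> [phi Ef]; exists (FScale c phi) => a /=; rewrite Ef. Qed.

Lemma definableD n (f g : ('I_n -> carrier M) -> R) :
  definable f -> definable g -> definable (fun a => f a + g a).
Proof. by move=> [phi Ef] [psi Eg]; exists (FAdd phi psi) => a /=; rewrite Ef Eg. Qed.

Lemma definableB n (f g : ('I_n -> carrier M) -> R) :
  definable f -> definable g -> definable (fun a => f a - g a).
Proof.
move=> df /(definableZ (-1)) dg.
by apply: definable_ext (definableD df dg) _ => a; rewrite mulN1r.
Qed.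

Lemma definable_cst n c : definable (fun _ : 'I_n -> carrier M => c).
Proof. by exists (FScale c (FOne L n)) => a /=; rewrite mulr1. Qed.

Lemma definable_dist n (i j : 'I_n) :
  definable (fun a : 'I_n -> carrier M => dist (a i) (a j)).
Proof. by exists (FDist (TVar L i) (TVar L j)). Qed.

Lemma definable_rename n m (s : 'I_n -> 'I_m) (f : ('I_n -> carrier M) -> R) :
  definable f -> definable (fun a => f (a \o s)).
Proof. by move=> [phi Ef]; exists (frename phi s) => a; rewrite feval_rename Ef. Qed.

Lemma definable_max n (g : ('I_n.+1 -> carrier M) -> R) (f : ('I_n -> carrier M) -> R) :
  definable g -> (forall a x, g (ext_env a x) <= f a) ->
  (forall a, exists x, g (ext_env a x) = f a) -> definable f.
Proof.
move=> [phi Eg] gf fg; exists (FSup phi) => a /=; apply: sup_max.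
  by have [x <-] := fg a; exists x.
by move=> _ [x _ <-]; rewrite Eg.
Qed.

Lemma definable_min n (g : ('I_n.+1 -> carrier M) -> R) (f : ('I_n -> carrier M) -> R) :
  definable g -> (forall a x, f a <= g (ext_env a x)) ->
  (forall a, exists x, g (ext_env a x) = f a) -> definable f.
Proof.
move=> [phi Eg] gf fg; exists (FInf phi) => a /=; apply: inf_min.
  by have [x <-] := fg a; exists x.
by move=> _ [x _ <-]; rewrite Eg.
Qed.

Lemma definable_bounded n (f : ('I_n -> carrier M) -> R) :
  definable f -> exists2 B : R, 0 < B & forall a, `|f a| <= B.
Proof.
move=> [phi Ef]; have [B BP] := feval_bounded M phi.
exists (Num.max 1 B) => [|a]; first by rewrite lt_max ltr01.
by rewrite -Ef le_max BP orbT.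
Qed.

(** The indicator of equality, the metric being discrete. *)
Definition eqi (x y : carrier M) : R := 1 - dist x y.

Lemma dist_id (x : carrier M) : dist x x = 0.
Proof. by apply/dist_sep. Qed.

Lemma dist_neq (x y : carrier M) : x <> y -> dist x y = 1.
Proof. by move=> xy; case: (foM.1 x y) => // /dist_sep. Qed.

Lemma eqi_id x : eqi x x = 1.
Proof. by rewrite /eqi dist_id subr0. Qed.

Lemma eqi_neq x y : x <> y -> eqi x y = 0.
Proof. by move=> /dist_neq xy; rewrite /eqi xy subrr. Qed.

(** The bound [1 / 4] makes [f] vary by at most half the distance, so the penalties decide where [g]
    is maximal: at [x3], or possibly at [x1] when [x1 = x2]. Both cases are checked on the finitely
    many patterns of equality. *)
Lemma max_near_three (f : carrier M -> R) x1 x2 x3 :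
  (forall x, `|f x| <= 1 / 4) ->
  let g w := f w - dist w x1 - dist w x2 - 2 * dist w x3 in
  let v := f x3 + eqi x1 x2 * Num.max 0 (f x1 - f x3)
           - dist x1 x3 - dist x2 x3 in
  (forall w, g w <= v) /\ exists w, g w = v.
Proof.
move=> fle g v.
have B x : - (1 / 4) <= f x <= 1 / 4 by rewrite -ler_norml.
have /andP[? ?] := B x1; have /andP[? ?] := B x2; have /andP[? ?] := B x3.
have lipf (x y : carrier M) : f x - f y <= dist x y / 2.
  have /andP[? ?] := B x; have /andP[? ?] := B y.
  by have [->|/dist_neq ->] := pselect (x = y); rewrite ?dist_id; lra.
rewrite /v /g; split=> [w|].
  have := lipf w x1; have := lipf w x3; have := dist_le1 x1 x3; have := dist_le1 x2 x3.
  have := dist_tri x1 w x3; have := dist_tri x2 w x3; have := dist_tri x1 w x2.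
  rewrite !(dist_sym _ w); have [<-|/[dup] /dist_neq E12 /eqi_neq ->] := pselect (x1 = x2).
    rewrite eqi_id; have [|] := lerP 0 (f x1 - f x3) => ?;
    have [->|->] := foM.1 w x1; have [->|->] := foM.1 w x3; lra.
  by rewrite E12; have [->|->] := foM.1 w x1; have [->|->] := foM.1 w x3; lra.
have [<-|/eqi_neq ->] := pselect (x1 = x2); last first.
  by exists x3; rewrite dist_id !(dist_sym x3); lra.
rewrite eqi_id; have [|] := lerP 0 (f x1 - f x3) => ?.
  by exists x1; rewrite dist_id; lra.
by exists x3; rewrite dist_id !(dist_sym x3); lra.
Qed.

(* The double penalty at [x3] makes [x3] the best choice for [w] unless
   [x1 = x2], in which case [x1] competes with [x3] on equal terms. *)
Lemma definable_eqi_max n m (f : ('I_n.+1 -> carrier M) -> R) (s : 'I_n -> 'I_m)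
    (i1 i2 i3 : 'I_m) : definable f ->
  definable (fun a => eqi (a i1) (a i2) *
    Num.max 0 (f (ext_env (a \o s) (a i1)) - f (ext_env (a \o s) (a i3)))).
Proof.
move=> df; have [B B0 BP] := definable_bounded df.
(* This factor brings [f] below the bound [1 / 4] required by [max_near_three]. *)
pose e := 1 / (4 * B).
have e0 : 0 < e by rewrite divr_gt0 ?mulr_gt0.
pose v a := e * f (ext_env (a \o s) (a i3)) + eqi (a i1) (a i2) * Num.max 0
    (e * f (ext_env (a \o s) (a i1)) - e * f (ext_env (a \o s) (a i3)))
    - dist (a i1) (a i3) - dist (a i2) (a i3).
pose g (b : 'I_m.+1 -> carrier M) := e * f (b \o ren_lift s)
   - dist (b ord_max) (b (lift ord_max i1)) - dist (b ord_max) (b (lift ord_max i2))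
   - 2 * dist (b ord_max) (b (lift ord_max i3)).
have dg : definable g.
  apply: definableB; last by apply: definableZ; exact: definable_dist.
  apply: definableB; last exact: definable_dist.
  apply: definableB; last exact: definable_dist.
  by apply: definableZ; exact: definable_rename.
have gE a x : g (ext_env a x) = e * f (ext_env (a \o s) x) - dist x (a i1)
    - dist x (a i2) - 2 * dist x (a i3).
  by rewrite /g ext_env_ren !ext_env_max !ext_env_lift.
have eB a x : `|e * f (ext_env (a \o s) x)| <= 1 / 4.
  rewrite normrM gtr0_norm// (le_trans (ler_wpM2l (ltW e0) (BP _)))//.
  rewrite /e; have -> : 1 / (4 * B) * B = 1 / 4 by field; exact: lt0r_neq0.
  by [].
have dv : definable v.
  apply: (definable_max dg) => [a x|a].
    by have [+ _] := max_near_three (a i1) (a i2) (a i3) (eB a); rewrite gE; apply.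
  have [_ [w wP]] := max_near_three (a i1) (a i2) (a i3) (eB a).
  by exists w; rewrite gE wP.
have df3 : definable (fun a : 'I_m -> carrier M => f (ext_env (a \o s) (a i3))).
  (* The substitution of the variable [i3] for the last variable of [f]. *)
  pose t (i : 'I_n.+1) := if unlift ord_max i is Some j then s j else i3.
  apply: definable_ext (definable_rename t df) _ => a; congr f; apply/funext => i.
  by rewrite /t /ext_env /=; case: unlift.
(* Removing from [v] its term at [i3] and its distances, then dividing by [e], leaves the product
   with [eqi]. *)
apply: definable_ext (definableZ e^-1 (definableD (definableD
  (definableB dv (definableZ e df3)) (definable_dist i1 i3)) (definable_dist i2 i3))) _.
move=> a; rewrite /v; set X := f _; set Y := f _.
rewrite -mulrBr -[X in Num.max X _](mulr0 e) -maxr_pMr ?(ltW e0)//.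
by field; exact: lt0r_neq0.
Qed.

(** A real [x] equals [max 0 x - max 0 (- x)]; the second term comes from [definable_eqi_max] for
    [- f]. *)
Lemma definable_eqi_diff n m (f : ('I_n.+1 -> carrier M) -> R) (s : 'I_n -> 'I_m)
    (i1 i2 i3 : 'I_m) : definable f ->
  definable (fun a => eqi (a i1) (a i2) *
    (f (ext_env (a \o s) (a i1)) - f (ext_env (a \o s) (a i3)))).
Proof.
move=> df; have dNf := definableZ (-1) df.
apply: definable_ext (definableB (definable_eqi_max s i1 i2 i3 df)
  (definable_eqi_max s i1 i2 i3 dNf)) _ => a /=.
set X := f _; set Y := f _; rewrite -mulrBr; congr (_ * _).
by have [|] := lerP 0 (X - Y) => ?; have [|] := lerP 0 (-1 * X - -1 * Y) => ?; lra.
Qed.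

(* With [g] the infimum of [f] over its last variable, [e (f - g)] is a supremum
   of the functions of [definable_eqi_diff], and [g] has one variable less. *)
Lemma definable_eqi_mul n m (f : ('I_n -> carrier M) -> R) (s : 'I_n -> 'I_m)
    (i j : 'I_m) : definable f ->
  definable (fun a => eqi (a i) (a j) * f (a \o s)).
Proof.
elim: n f m s i j => [|n IH] f m s i j df.
  have a0 : 'I_0 -> carrier M by case.
  apply: definable_ext (definableB (definable_cst m (f a0))
    (definableZ (f a0) (definable_dist i j))) _ => a.
  have -> : a \o s = a0 by apply/funext; case.
  by rewrite /eqi; ring.
have minf (b : 'I_n -> carrier M) :
    exists y, forall x, f (ext_env b y) <= f (ext_env b x).
  have [||_ [x _ <-] mP] := @finite_set_min R (range (fun x => f (ext_env b x))).
  - apply: sub_finite_set (definable_finite df) => _ [x _ <-].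
    by exists (ext_env b x).
  - by exists (f (ext_env b (s_point M))), (s_point M).
  by exists x => z; apply: mP; exists z.
have [y yP] := choice minf.
pose g b := f (ext_env b (y b)).
have dg : definable g.
  by apply: (definable_min df) => [a x|a]; [exact: yP|exists (y a)].
pose s' k := s (lift ord_max k).
have sE (a : 'I_m -> carrier M) : a \o s = ext_env (a \o s') (a (s ord_max)).
  by rewrite -[LHS]ext_env_eta.
pose l := @lift m.+1 ord_max.
(* Subtracting two instances cancels the value of [f] at [l i], so two arbitrary variables can be
   compared. *)
have dd (k1 k2 : 'I_m.+1) : definable (fun b : 'I_m.+1 -> carrier M =>
    eqi (b (l i)) (b (l j)) * (f (ext_env (b \o l \o s') (b k1))
                               - f (ext_env (b \o l \o s') (b k2)))).
  apply: definable_ext (definableB (definable_eqi_diff (l \o s') (l i) (l j) k2 df)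
    (definable_eqi_diff (l \o s') (l i) (l j) k1 df)) _ => b.
  rewrite compA; set e := eqi _ _; set u := f _; set v := f _; set w := f _.
  by clearbody e u v w; ring.
(* The new last variable ranges over the point subtracted; the supremum is attained at the minimiser
   [y] and equals [eqi] times [f - g]. The induction hypothesis adds [eqi] times [g]. *)
apply: definable_ext (definableD (definable_max (dd (l (s ord_max)) ord_max)
  (f := fun a => eqi (a i) (a j) * (f (a \o s) - g (a \o s'))) _ _)
  (IH g m s' i j dg)) _ => [a x|a|a].
- rewrite !ext_env_lift ext_env_max.
  have -> : ext_env a x \o l = a by apply/funext => k; rewrite /= ext_env_lift.
  rewrite -sE ler_wpM2l//; first by rewrite subr_ge0 dist_le1.
  by rewrite lerD2l lerN2 yP.
- exists (y (a \o s')); rewrite !ext_env_lift ext_env_max.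
  have -> : ext_env a (y (a \o s')) \o l = a.
    by apply/funext => k; rewrite /= ext_env_lift.
  by rewrite -sE.
- by rewrite -mulrDr subrK.
Qed.

(** The supremum over [w] of [eqi w x * (f - g) + g] sees both [f], at [w = x], and [g], at any
    other [w]. The arity [n.+1] supplies the variable [x], and a one-point structure, where all
    functions are constant, is treated apart. *)
Lemma definable_maxr n (f g : ('I_n.+1 -> carrier M) -> R) :
  definable f -> definable g -> definable (fun a => Num.max (f a) (g a)).
Proof.
move=> df dg; have [M1|/existsNP[x0 /existsNP[x1 x01]]] :=
  pselect (forall x y : carrier M, x = y).
  have a0 : 'I_n.+1 -> carrier M := fun=> s_point M.
  apply: definable_ext (definable_cst n.+1 (Num.max (f a0) (g a0))) _ => a.
  by have -> : a = a0 by apply/funext => i; exact: M1.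
have xneq (x : carrier M) : exists w, w <> x.
  have [x0x|] := pselect (x0 = x); last by exists x0.
  by exists x1 => x1x; apply: x01; rewrite x1x.
pose l := @lift n.+2 ord_max; pose i0 := @ord0 n.
pose h (b : 'I_n.+2 -> carrier M) :=
  eqi (b ord_max) (b (l i0)) * (f (b \o l) - g (b \o l)) + g (b \o l).
have hE a x : h (ext_env a x) = eqi x (a i0) * (f a - g a) + g a.
  rewrite /h ext_env_max ext_env_lift.
  by have -> : ext_env a x \o l = a by apply/funext => k; rewrite /= ext_env_lift.
apply: (@definable_max _ h).
- apply: definableD; last exact: definable_rename.
  exact: (definable_eqi_mul l ord_max (l i0) (definableB df dg)).
- move=> a x; rewrite hE le_max.
  have [->|/eqi_neq ->] := pselect (x = a i0).
    by rewrite eqi_id mul1r subrK lexx.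
  by rewrite mul0r add0r lexx orbT.
- move=> a; have [|] := lerP (f a) (g a) => _.
    by have [w /eqi_neq wa] := xneq (a i0); exists w; rewrite hE wa mul0r add0r.
  by exists (a i0); rewrite hE eqi_id mul1r subrK.
Qed.

End Definable.

(** * States of a space of finite-valued functions *)

HB.instance Definition _ (R : realType) (I : Type) :=
  isPointed.Build {ptws I -> R} (fun=> 0).

(** * The topology of pointwise convergence *)

Section PointwiseTopology.
Variables (R : realType) (I : Type).
Local Notation X := {ptws I -> R}.

Lemma eval_continuous (i : I) : continuous (fun p : X => p i).
Proof. exact: (@proj_continuous {classic I} (fun=> R) i). Qed.

Lemma ptws_hausdorff : hausdorff_space X.
Proof.
by apply: (@hausdorff_product {classic I} (fun=> R)) => _; exact: Rhausdorff.
Qed.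

(* The sets on the right-hand side form a filter converging to [q] in every
   coordinate, hence in the product topology. *)
Lemma nbhs_ptws (q : X) (U : set X) : nbhs q U ->
  exists (F : seq I) (e : R), 0 < e /\
    forall r : X, (forall i, List.In i F -> `|r i - q i| < e) -> U r.
Proof.
pose G : set_system X := [set V | exists (F : seq I) (e : R), 0 < e /\
    forall r : X, (forall i, List.In i F -> `|r i - q i| < e) -> V r].
have FG : Filter G.
  split.
  - by exists [::], 1.
  - move=> V W [F [e [e0 FV]]] [F' [e' [e'0 FW]]].
    exists (F ++ F'), (Num.min e e'); split=> [|r rP]; first by rewrite lt_min e0.
    split; [apply: FV|apply: FW] => i iF;
      by have := rP i; rewrite lt_min => /(_ _)/andP[]//; apply/List.in_or_app; auto.
  - by move=> V W VW [F [e [e0 FV]]]; exists F, e; split=> // r /FV /VW.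
suff : G --> q by apply.
apply/cvg_sup => i; apply/cvg_image.
  by rewrite eqEsubset; split=> v // _; exists (cst v).
move=> V /nbhs_ballP[e /= e0 eV].
exists [set r : X | V (r i)]; last first.
  by rewrite eqEsubset; split=> [v [r Vr <-]//|v Vv]; exists (cst v).
exists [:: i], e; split=> // r /(_ i) H; apply: eV.
by rewrite /ball /= distrC; apply: H; left.
Qed.

Lemma closed_forall (T : Type) (C : T -> set X) :
  (forall x, closed (C x)) -> closed [set p | forall x, C x p].
Proof.
move=> cC; have -> : [set p | forall x, C x p] = \bigcap_(x in setT) C x.
  by apply/seteqP; split=> p /= H => [x _|x]; [exact: H|exact: H].
by apply: closed_bigI => x _.
Qed.

Lemma closed_preimage (f : X -> R) (C : set R) :
  continuous f -> closed C -> closed (f @^-1` C).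
Proof. by move=> cf; apply: closed_comp => x _; exact: cf. Qed.

Lemma open_preimage (f : X -> R) (U : set R) :
  continuous f -> open U -> open (f @^-1` U).
Proof. by move=> cf; apply: open_comp => x _; exact: cf. Qed.

Lemma closed_eqfun (f g : X -> R) :
  continuous f -> continuous g -> closed [set p | f p = g p].
Proof.
move=> cf cg.
have -> : [set p | f p = g p] = (fun p => f p - g p) @^-1` [set 0].
  by apply/seteqP; split=> p /= => [->|/eqP]; rewrite ?subrr// subr_eq0 => /eqP.
apply: closed_preimage; last exact: closed_eq.
by move=> p; exact: (@continuousB R R^o X f g p (cf p) (cg p)).
Qed.

Lemma compact_bounded_eval (b : I -> R) :
  compact [set p : X | forall i, - b i <= p i <= b i].
Proof.
have := @tychonoff {classic I} (fun=> R) (fun i => `[- b i, b i]%classic)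
  (fun i => @segment_compact R (- b i) (b i)).
congr compact; apply/seteqP; split=> p H i; have := H i; by rewrite /= in_itv.
Qed.

End PointwiseTopology.

Arguments eval_continuous {R I} i p : rename.

(** * The vector lattice of represented functions and its Boolean algebra of sets *)

Section States.
Variables (R : realType) (I S : Type) (ev : I -> S -> R) (s0 : S).

Definition represented (f : S -> R) : Prop := exists i, ev i = f.

Hypothesis repr1 : represented (fun=> 1).
Hypothesis reprD : forall f g,
  represented f -> represented g -> represented (fun s => f s + g s).
Hypothesis reprZ : forall c f, represented f -> represented (fun s => c * f s).
Hypothesis repr_max : forall f g,
  represented f -> represented g -> represented (fun s => Num.max (f s) (g s)).
Hypothesis repr_finite : forall f, represented f -> finite_set (range f).

Lemma repr_cst c : represented (fun=> c).
Proof. by have := reprZ c repr1; congr represented; apply/funext => s; rewrite mulr1. Qed.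

Lemma reprB f g : represented f -> represented g -> represented (fun s => f s - g s).
Proof.
move=> rf rg; have := reprD rf (reprZ (-1) rg); congr represented.
by apply/funext => s; rewrite mulN1r.
Qed.

Lemma repr_min f g :
  represented f -> represented g -> represented (fun s => Num.min (f s) (g s)).
Proof.
move=> rf rg; have := reprB (reprD rf rg) (repr_max rf rg); congr represented.
by apply/funext => s; apply/eqP; rewrite subr_eq addr_min_max.
Qed.

Lemma repr_sum (J : Type) (l : seq J) (f : J -> S -> R) :
  (forall j, represented (f j)) -> represented (fun s => \sum_(j <- l) f j s).
Proof.
move=> rf; elim: l => [|j l IH].
  by have := repr_cst 0; congr represented; apply/funext => s; rewrite big_nil.
by have := reprD (rf j) IH; congr represented; apply/funext => s; rewrite big_cons.
Qed.

Lemma repr_bounded f : represented f -> exists2 B, 0 < B & forall s, `|f s| <= B.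
Proof.
move=> rf; have fin : finite_set ((fun x => `|x|) @` range f).
  by apply: finite_image; exact: repr_finite.
have [|m [x _ xm] mP] := finite_set_max fin; first by exists `|f s0|, (f s0).
exists (m + 1) => [|s]; first by rewrite -xm ltr_wpDl.
by rewrite (le_trans (mP `|f s| _)) ?lerDl//; exists (f s) => //; exists s.
Qed.

(** These sets will correspond to the clopen subsets of the space of two-valued states, by way of
    [hat]. *)
Definition clop (A : set S) : Prop := represented \1_A.

Lemma clop_setT : clop setT.
Proof. by move: repr1; congr represented; apply/funext => s; rewrite indicE in_setT. Qed.

Lemma clopC A : clop A -> clop (~` A).
Proof.
move=> cA; have := reprB repr1 cA; congr represented; apply/funext => s.
by rewrite !indicE in_setC; case: (_ \in _); rewrite ?subrr ?subr0.
Qed.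

Lemma clopI A B : clop A -> clop B -> clop (A `&` B).
Proof.
move=> cA cB; have := repr_min cA cB; congr represented; apply/funext => s.
by rewrite !indicE in_setI; case: (s \in A); case: (s \in B);
  rewrite minEle ler_nat.
Qed.

Lemma clopU A B : clop A -> clop B -> clop (A `|` B).
Proof. by move=> /clopC cA /clopC cB; have := clopC (clopI cA cB); rewrite setCI !setCK. Qed.

Lemma clopD A B : clop A -> clop B -> clop (A `\` B).
Proof. by move=> cA /clopC cB; rewrite setDE; exact: clopI. Qed.

Lemma clop_set0 : clop set0.
Proof. by rewrite -setCT; exact/clopC/clop_setT. Qed.

(** With [B] a bound of [f], the product is the lattice expression
    [min (f + B) (2 B 1_A) - B 1_A]. *)
Lemma repr_mul_indic f A : represented f -> clop A -> represented (fun s => f s * \1_A s).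
Proof.
move=> rf cA; have [B B0 fB] := repr_bounded rf.
have := reprB (repr_min (reprD rf (repr_cst B)) (reprZ (2 * B) cA)) (reprZ B cA).
congr represented; apply/funext => s; have := fB s; rewrite ler_norml => /andP[f1 f2].
rewrite indicE; case: (s \in A); rewrite ?mulr1 ?mulr0.
  by rewrite min_l; [rewrite addrK|lra].
by rewrite min_r; [rewrite subr0|lra].
Qed.

(** A finite range leaves a gap [d] around [c], and then [max 0 (1 - |f - c| / d)] is the indicator
    of the fiber. *)
Lemma clop_fiber f c : represented f -> clop [set s | f s = c].
Proof.
move=> rf; pose D := (fun x => `|x - c|) @` (range f `\ c).
have [/set0P D0|/negP/negbNE/eqP D0] := pselect (D != set0); last first.
  have -> : [set s | f s = c] = setT; last exact: clop_setT.
  apply/seteqP; split=> // s _ /=; apply: contrapT => sc.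
  suff : D `|f s - c| by rewrite D0.
  by exists (f s) => //; split=> //; exists s.
have [|_ [x [_ xc] <-] mP] := @finite_set_min _ D _ D0.
  by apply: finite_image; apply: finite_setD; exact: repr_finite.
set d := `|x - c|; have d0 : 0 < d by rewrite normr_gt0 subr_eq0; apply/eqP.
have rg : represented (fun s => 1 - d^-1 * Num.max (f s - c) (-1 * (f s - c))).
  apply: reprB => //; apply: reprZ; apply: repr_max; last apply: reprZ;
    by apply: reprB => //; exact: repr_cst.
have := repr_max (repr_cst 0) rg; congr represented; apply/funext => s.
rewrite indicE mulN1r; have [fc|fc] := pselect (f s = c).
  by rewrite mem_set// fc subrr oppr0 maxxx mulr0 subr0 max_r.
rewrite memNset// max_l// subr_le0 mulrC ler_pdivlMr// mul1r.
have -> : Num.max (f s - c) (- (f s - c)) = `|f s - c|.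
  by rewrite maxC; have [h|h] := lerP 0 (f s - c); [rewrite ger0_norm//|rewrite ltr0_norm//];
    have [] := lerP; lra.
by apply: mP; exists (f s) => //; split=> //; exists s.
Qed.

Lemma repr_fibers f : represented f -> exists2 l : seq R, uniq l &
  forall s, f s \in l.
Proof.
move=> /repr_finite/finite_seqP[l lE]; exists (undup l); first exact: undup_uniq.
by move=> s; rewrite mem_undup; have : range f (f s) by []; rewrite lE.
Qed.

Lemma sum_indic_fibers (f : S -> R) (l : seq R) (g : R -> R) s : uniq l -> f s \in l ->
  \sum_(c <- l) g c * \1_[set s | f s = c] s = g (f s).
Proof.
move=> ul sl; rewrite (bigD1_seq (f s))//= indicE mem_set// mulr1 big1 ?addr0// => c cf.
by rewrite indicE memNset ?mulr0//= => fc; rewrite fc eqxx in cf.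
Qed.

(** A chosen index of [f], with an index of the constant 1 as default. Through it [val] applies a
    functional on indices to functions. *)
Definition idx (f : S -> R) : I :=
  match pselect (represented f) with
  | left rf => projT1 (cid rf)
  | right _ => projT1 (cid repr1)
  end.

Lemma idxP f : represented f -> ev (idx f) = f.
Proof. by rewrite /idx; case: pselect => // rf _; case: cid. Qed.

Definition val (p : I -> R) (f : S -> R) : R := p (idx f).

(** Since [I] carries no operations, linearity is imposed on every index representing a sum or a
    multiple. The factor 1 gives equal values on indices of the same function. *)
Definition state (p : I -> R) : Prop :=
  [/\ forall i j k, ev k = (fun s => ev i s + ev j s) -> p k = p i + p j,
      forall c i k, ev k = (fun s => c * ev i s) -> p k = c * p i,
      forall i, (forall s, 0 <= ev i s) -> 0 <= p i &
      forall i, ev i = (fun=> 1) -> p i = 1].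

Definition prb (p : I -> R) (A : set S) : R := val p \1_A.

(** * The finitely additive probability of a state *)

Section OneState.
Variables (p : I -> R).
Hypothesis stp : state p.

Lemma val_ev i : val p (ev i) = p i.
Proof.
case: stp => _ pZ _ _; rewrite -[RHS]mul1r; apply: pZ.
by rewrite idxP; [apply/funext => s; rewrite mul1r|exists i].
Qed.

Lemma valD f g : represented f -> represented g ->
  val p (fun s => f s + g s) = val p f + val p g.
Proof. by case: stp => pD _ _ _ rf rg; apply: pD; rewrite !idxP//; exact: reprD. Qed.

Lemma valZ c f : represented f -> val p (fun s => c * f s) = c * val p f.
Proof. by case: stp => _ pZ _ _ rf; apply: pZ; rewrite !idxP//; exact: reprZ. Qed.

Lemma val_ge0 f : represented f -> (forall s, 0 <= f s) -> 0 <= val p f.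
Proof. by case: stp => _ _ p0 _ rf f0; apply: p0; rewrite idxP. Qed.

Lemma val1 : val p (fun=> 1) = 1.
Proof. by case: stp => _ _ _ p1; apply: p1; rewrite idxP. Qed.

Lemma val_cst c : val p (fun=> c) = c.
Proof.
rewrite -[RHS]mulr1 -val1 -valZ//; congr val.
by apply/funext => s; rewrite mulr1.
Qed.

Lemma valB f g : represented f -> represented g ->
  val p (fun s => f s - g s) = val p f - val p g.
Proof.
move=> rf rg; rewrite -[in RHS]mulN1r -valZ// -valD//; last exact: reprZ.
by congr val; apply/funext => s; rewrite mulN1r.
Qed.

Lemma le_val f g : represented f -> represented g -> (forall s, f s <= g s) ->
  val p f <= val p g.
Proof.
move=> rf rg fg; rewrite -subr_ge0 -valB//; apply: val_ge0; first exact: reprB.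
by move=> s; rewrite subr_ge0.
Qed.

Lemma norm_val_le f B : represented f -> (forall s, `|f s| <= B) -> `|val p f| <= B.
Proof.
move=> rf fB; have fs s : - B <= f s <= B by rewrite -ler_norml.
have lo : val p (fun=> - B) <= val p f.
  by apply: le_val => // [|s]; [exact: repr_cst|have /andP[] := fs s].
have hi : val p f <= val p (fun=> B).
  by apply: le_val => // [|s]; [exact: repr_cst|have /andP[] := fs s].
by move: lo hi; rewrite !val_cst ler_norml => -> ->.
Qed.

Lemma val_sum (J : Type) (l : seq J) (f : J -> S -> R) :
  (forall j, represented (f j)) ->
  val p (fun s => \sum_(j <- l) f j s) = \sum_(j <- l) val p (f j).
Proof.
move=> rf; elim: l => [|j l IH].
  rewrite big_nil -[RHS](val_cst 0); congr val; apply/funext => s.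
  by rewrite big_nil.
rewrite big_cons -IH -valD//; last exact: repr_sum.
by congr val; apply/funext => s; rewrite big_cons.
Qed.

Lemma prb_ge0 A : clop A -> 0 <= prb p A.
Proof. by move=> cA; apply: val_ge0 => // s; rewrite indicE. Qed.

Lemma prb_setT : prb p setT = 1.
Proof. by rewrite -val1; congr val; apply/funext => s; rewrite indicE in_setT. Qed.

Lemma le_prb A B : clop A -> clop B -> A `<=` B -> prb p A <= prb p B.
Proof.
move=> cA cB AB; apply: le_val => // s; rewrite !indicE ler_nat.
have [/set_mem/AB/mem_set->//|//] := boolP (s \in A).
Qed.

Lemma prb_le1 A : clop A -> prb p A <= 1.
Proof. by move=> cA; rewrite -prb_setT; apply: le_prb => //; exact: clop_setT. Qed.

Lemma prbU A B : clop A -> clop B -> A `&` B = set0 ->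
  prb p (A `|` B) = prb p A + prb p B.
Proof.
move=> cA cB AB0; rewrite /prb -valD//; congr val; apply/funext => s.
rewrite !indicE in_setU; have [sA|] := boolP (s \in A); last by rewrite add0r.
suff /negPf -> : s \notin B by rewrite addr0.
apply/negP => sB; have : (A `&` B) s by split; exact: set_mem.
by rewrite AB0.
Qed.

Lemma prb_set0 : prb p set0 = 0.
Proof.
by rewrite -[RHS](val_cst 0); congr val; apply/funext => s; rewrite indicE in_set0.
Qed.

Lemma prbC A : clop A -> prb p (~` A) = 1 - prb p A.
Proof.
move=> cA; rewrite -prb_setT -(setUv A) prbU ?setICr//; last exact: clopC.
by rewrite addrC addKr.
Qed.

Lemma prbD A B : clop A -> clop B ->
  prb p A = prb p (A `&` B) + prb p (A `\` B).
Proof.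
move=> cA cB; rewrite -prbU; [by rewrite setUIDK|exact: clopI|exact: clopD|].
by rewrite setDE setIACA setICr setI0.
Qed.

Lemma prbI1 A B : clop A -> clop B -> prb p A = 1 -> prb p B = 1 ->
  prb p (A `&` B) = 1.
Proof.
move=> cA cB pA pB; have cAB := clopI cA cB; have cAB' := clopD cA cB.
have := prbD cA cB; have := prb_ge0 cAB'; have := prb_le1 cAB.
have : prb p (A `\` B) <= prb p (~` B).
  by apply: le_prb => //; exact: clopC.
rewrite prbC// pA pB; lra.
Qed.

(** Represented functions are simple, so a state is the finitely additive integral against [prb].
    Hence [prb] determines the state. *)
Lemma val_fibers f (l : seq R) (g : R -> R) : represented f -> uniq l ->
  (forall s, f s \in l) ->
  val p (g \o f) = \sum_(c <- l) g c * prb p [set s | f s = c].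
Proof.
move=> rf ul fl; rewrite -(eq_bigr _ (fun c _ => valZ (g c) (clop_fiber c rf))).
rewrite -(val_sum _ (f := fun c s => g c * \1_[set s | f s = c] s)); last first.
  by move=> c; apply: reprZ; exact: clop_fiber.
by congr val; apply/funext => s; rewrite sum_indic_fibers.
Qed.

End OneState.

Lemma state_eq p q : state p -> state q ->
  (forall A, clop A -> prb p A = prb q A) -> p = q.
Proof.
move=> sp sq pq; apply/funext => i; have ri : represented (ev i) by exists i.
have [l ul il] := repr_fibers ri.
rewrite -(val_ev sp) -(val_ev sq) -[ev i]/(id \o ev i).
rewrite (val_fibers sp id ri ul il) (val_fibers sq id ri ul il).
by apply: eq_bigr => c _; rewrite pq//; exact: clop_fiber.
Qed.

(** * Dirac states, two-valued states and extreme points *)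

Definition point (s : S) : I -> R := fun i => ev i s.

Lemma val_point s f : represented f -> val (point s) f = f s.
Proof. by move=> rf; rewrite /val /point idxP. Qed.

Lemma state_point s : state (point s).
Proof.
split; rewrite /point.
- by move=> i j k ->.
- by move=> c i k ->.
- by move=> i; apply.
- by move=> i ->.
Qed.

Definition character (p : I -> R) : Prop :=
  state p /\ forall A, clop A -> prb p A = 0 \/ prb p A = 1.

Lemma character_point s : character (point s).
Proof.
split; first exact: state_point.
by move=> A cA; rewrite /prb val_point// indicE; case: (_ \in _); [right|left].
Qed.

(** Some fiber has probability 1, as finitely many null fibers cannot have total mass 1. If it lies
    over [c], then [|f - c|] is at most a multiple of a null indicator, so the value of [f] is
    [c]. *)
Lemma character_fiber p f : character p -> represented f ->
  prb p [set s | f s = val p f] = 1.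
Proof.
move=> [sp p01] rf; have [l ul fl] := repr_fibers rf.
have [c pc1] : exists c, prb p [set s | f s = c] = 1.
  apply: contrapT => /forallNP pn1.
  have := val_fibers sp (fun=> 1) rf ul fl; rewrite [LHS](val1 sp) big1 => [/eqP|c _].
    by rewrite oner_eq0.
  by rewrite mul1r; have [|/pn1] := p01 _ (clop_fiber c rf).
suff -> : val p f = c by [].
have [B B0 fB] := repr_bounded (reprB rf (repr_cst c)).
have cN := clopC (clop_fiber c rf).
have pN : val p (\1_(~` [set s | f s = c])) = 0.
  by have := prbC sp (clop_fiber c rf); rewrite pc1 subrr.
have fc s : `|f s - c| <= B * \1_(~` [set s | f s = c]) s.
  rewrite indicE; have [fsc|fsc] := pselect (f s = c).
    by rewrite memNset ?mulr0 ?fsc ?subrr ?normr0//=; apply.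
  by rewrite mem_set// mulr1.
have rfc := reprB rf (repr_cst c).
have := valB sp rf (repr_cst c); rewrite (val_cst sp) => Efc.
apply/eqP; rewrite -subr_eq0 -Efc eq_le; apply/andP; split.
  have -> : 0 = val p (fun s => B * \1_(~` [set s | f s = c]) s).
    by rewrite valZ// pN mulr0.
  apply: le_val => //; first exact: reprZ.
  by move=> s; rewrite (le_trans (ler_norm _)).
have -> : 0 = val p (fun s => - B * \1_(~` [set s | f s = c]) s).
  by rewrite valZ// pN mulr0.
apply: le_val => //; first exact: reprZ.
by move=> s; rewrite mulNr lerNl (le_trans _ (fc s))// -normrN ler_norm.
Qed.

(** The points that agree with [p] on the coordinates [F]; such sets yield the basic neighbourhoods
    of a two-valued state. *)
Definition cell (p : I -> R) (F : seq I) : set S :=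
  [set s | map (point s) F = map p F].

Lemma clop_cell p F : clop (cell p F).
Proof.
elim: F => [|i F IH]; first by have := clop_setT; congr clop; apply/seteqP; split.
have : clop ([set s | ev i s = p i] `&` cell p F).
  by apply: clopI => //; apply: clop_fiber; exists i.
by congr clop; apply/seteqP; split=> s /= => [[si sF]|[si sF]]; rewrite /cell /= /point ?si ?sF.
Qed.

Lemma character_cell p F : character p -> prb p (cell p F) = 1.
Proof.
move=> chp; have [sp _] := chp; elim: F => [|i F IH].
  by rewrite -(prb_setT sp); congr prb; apply/seteqP; split.
have ri : represented (ev i) by exists i.
have := prbI1 sp (clop_fiber _ ri) (clop_cell p F) (character_fiber chp ri) IH.
rewrite (val_ev sp) => <-; congr prb.
by apply/seteqP; split=> s /= => [[si sF]|[si sF]]; rewrite /cell /= /point ?si ?sF.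
Qed.

Lemma cell_partition (F : seq I) : exists l : seq S,
  forall s, \sum_(t <- l) \1_(cell (point t) F) s = 1 :> R.
Proof.
have fin : finite_set (range (fun s => map (point s) F)).
  elim: F => [|i F IH] /=.
    by apply: (@sub_finite_set _ _ [set [::]]); [move=> _ [s _ <-]|exact: finite_set1].
  have fini : finite_set (range (ev i)) by apply: repr_finite; exists i.
  apply: (@sub_finite_set _ _ ((fun x => x.1 :: x.2) @`
    (range (ev i) `*` range (fun s => map (point s) F)))).
    by move=> _ [s _ <-]; exists (ev i s, map (point s) F).
  by apply: finite_image; exact: finite_setX.
have /finite_seqP[vs vsE] := fin.
(* One point is chosen for each attained vector of values; [s0] is a default for the others. *)
have /choice[t tP] : forall v, exists s, v \in vs -> map (point s) F = v.
  move=> v; have [vvs|] := boolP (v \in vs); last by move=> _; exists s0.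
  have : [set` vs] v by [].
  by rewrite -vsE => -[s _ sv]; exists s.
exists (map t (undup vs)) => s; rewrite big_map.
have svs : map (point s) F \in undup vs.
  rewrite mem_undup; have : range (fun s => map (point s) F) (map (point s) F) by exists s.
  by rewrite vsE.
rewrite (bigD1_seq (map (point s) F)) ?undup_uniq//= big_seq_cond big1 => [|v].
  rewrite addr0 indicE mem_set// /cell /= tP//.
  by rewrite -mem_undup.
rewrite mem_undup => /andP[vvs /eqP vs']; rewrite indicE memNset// /cell /= tP//.
by move=> E; apply: vs'.
Qed.

(** The conditional state given [A]. *)
Definition condition (p : I -> R) (A : set S) : I -> R :=
  fun i => val p (fun s => ev i s * \1_A s) / prb p A.

Lemma val_condition p A f : represented f ->
  val (condition p A) f = val p (fun s => f s * \1_A s) / prb p A.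
Proof. by move=> rf; rewrite {1}/val /condition idxP. Qed.

Lemma state_condition p A : state p -> clop A -> 0 < prb p A ->
  state (condition p A).
Proof.
move=> sp cA pA; have r i : represented (fun s => ev i s * \1_A s).
  by apply: repr_mul_indic => //; exists i.
split; rewrite /condition.
- move=> i j k ->; rewrite -mulrDl -valD//; congr (val _ _ / _).
  by apply/funext => s; rewrite mulrDl.
- move=> c i k ->; rewrite mulrA -valZ//; congr (val _ _ / _).
  by apply/funext => s; rewrite mulrA.
- move=> i i0; apply: divr_ge0; last exact: ltW.
  by apply: val_ge0 => // s; rewrite mulr_ge0.
- move=> i ->; have -> : (fun s => 1 * \1_A s) = \1_A :> (S -> R).
    by apply/funext => s; rewrite mul1r.
  by rewrite -/(prb p A) divff// gt_eqF.
Qed.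

Lemma state_cvx t p q : state p -> state q -> 0 <= t <= 1 -> state (cvx t p q).
Proof.
move=> [pD pZ p0 p1] [qD qZ q0 q1] /andP[t0 t1]; split; rewrite /cvx.
- by move=> i j k E; rewrite (pD _ _ _ E) (qD _ _ _ E); ring.
- by move=> c i k E; rewrite (pZ _ _ _ E) (qZ _ _ _ E); ring.
- by move=> i i0; rewrite addr_ge0// mulr_ge0 ?subr_ge0 ?p0 ?q0.
- by move=> i E; rewrite (p1 _ E) (q1 _ E); ring.
Qed.

Lemma extreme_points_state :
  extreme_points (state : set {ptws I -> R}) = (character : set {ptws I -> R}).
Proof.
apply/seteqP; split=> p.
  move=> [sp exp]; split=> // A cA; apply: contrapT => /not_orP[pA0 pA1].
  have p0 : 0 < prb p A by rewrite lt_neqAle eq_sym prb_ge0// andbT; apply/eqP.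
  have p1 : prb p A < 1 by rewrite lt_neqAle prb_le1// andbT; apply/eqP.
  have cA' := clopC cA; have pC := prbC sp cA.
  have pC0 : 0 < prb p (~` A) by rewrite pC subr_gt0.
  (* The law of total probability splits [p] properly, since conditioning on [A] raises the
     probability of [A] to 1. *)
  have E : p = cvx (prb p A) (condition p A) (condition p (~` A)).
    apply/funext => i; rewrite /cvx -pC /condition.
    have cancel (x y : R) : 0 < y -> y * (x / y) = x.
      by move=> y0; rewrite mulrC divfK// gt_eqF.
    rewrite !cancel//.
    have ri : represented (ev i) by exists i.
    rewrite -valD//; [|exact: repr_mul_indic..].
    rewrite -(val_ev sp); congr val; apply/funext => s.
    rewrite -mulrDr !indicE in_setC; case: (_ \in _); by rewrite ?addr0 ?add0r mulr1.
  have [|Ep _] := exp _ _ _ (state_condition sp cA p0) (state_condition sp cA' pC0) _ E.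
    by rewrite p0.
  have : prb (condition p A) A = 1.
    rewrite /prb val_condition//; have -> : (fun s => \1_A s * \1_A s) = \1_A :> (S -> R).
      by apply/funext => s; rewrite indicE; case: (_ \in _); rewrite ?mulr0 ?mulr1.
    by rewrite divff// gt_eqF.
  by rewrite Ep.
move=> [sp p01]; split=> // y z t sy sz /andP[t0 t1] E.
(* The numbers 0 and 1 are extreme in the unit interval. *)
have H A : clop A -> prb y A = prb p A /\ prb z A = prb p A.
  move=> cA; have : prb p A = t * prb y A + (1 - t) * prb z A by rewrite {1}E.
  have := prb_ge0 sy cA; have := prb_le1 sy cA.
  have := prb_ge0 sz cA; have := prb_le1 sz cA.
  have [->|->] := p01 _ cA; move: (prb y A) (prb z A) => a b b1 b0 a1 a0 tab.
    have ta : 0 <= t * a by rewrite mulr_ge0// ltW.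
    have tb : 0 <= (1 - t) * b by rewrite mulr_ge0// subr_ge0 ltW.
    have /eqP : t * a = 0 by lra.
    rewrite mulf_eq0 gt_eqF//= => /eqP ->.
    have /eqP : (1 - t) * b = 0 by lra.
    by rewrite mulf_eq0 subr_eq0 gt_eqF//= => /eqP ->.
  have ta : 0 <= t * (1 - a) by rewrite mulr_ge0 ?subr_ge0// ltW.
  have tb : 0 <= (1 - t) * (1 - b) by rewrite mulr_ge0 ?subr_ge0// ltW.
  have /eqP : t * (1 - a) = 0 by lra.
  rewrite mulf_eq0 gt_eqF//= subr_eq0 => /eqP <-.
  have /eqP : (1 - t) * (1 - b) = 0 by lra.
  by rewrite mulf_eq0 subr_eq0 gt_eqF//= subr_eq0 => /eqP <-.
by split; apply: state_eq => // A /H[].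
Qed.

(** * Compactness, and the Stone space of two-valued states *)

Local Notation X := {ptws I -> R}.
Local Notation K := (state : set X).
Local Notation E := (character : set X).

Lemma closed_state : closed K.
Proof.
have -> : K =
  [set p : X | forall i j k, ev k = (fun s => ev i s + ev j s) -> p k = p i + p j] `&`
  [set p : X | forall c i k, ev k = (fun s => c * ev i s) -> p k = c * p i] `&`
  [set p : X | forall i, (forall s, 0 <= ev i s) -> 0 <= p i] `&`
  [set p : X | forall i, ev i = (fun=> 1) -> p i = 1].
  by apply/seteqP; split=> p; [case=> ? ? ? ?; split=> //; split|case=> -[] []].
apply: closedI; first apply: closedI; first apply: closedI.
- apply: closed_forall => i; apply: closed_forall => j; do 2 apply: closed_forall => ?.
  apply: closed_eqfun => [|p]; first exact: eval_continuous.
  exact: (@continuousD R R^o X (fun p => p i) (fun p => p j) p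
    (eval_continuous i p) (eval_continuous j p)).
- apply: closed_forall => c; apply: closed_forall => i; do 2 apply: closed_forall => ?.
  apply: closed_eqfun => [|p]; first exact: eval_continuous.
  exact: (@continuousM R X (fun=> c) (fun p => p i) p (@cst_continuous _ _ c p)
    (eval_continuous i p)).
- apply: closed_forall => i; apply: closed_forall => _.
  exact: (closed_preimage (eval_continuous i) (@closed_ge _ 0)).
- apply: closed_forall => i; apply: closed_forall => _.
  exact: (closed_preimage (eval_continuous i) (@closed_eq _ 1)).
Qed.

(** Each coordinate of a state is bounded by a bound of its function, so [K] is closed in a product
    of segments. *)
Lemma compact_state : compact K.
Proof.
have /choice[b bP] : forall i, exists B : R, forall s, `|ev i s| <= B.
  move=> i; have [|B _ fB] := @repr_bounded (ev i); first by exists i.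
  by exists B.
apply: subclosed_compact closed_state (@compact_bounded_eval _ _ b) _ => p sp i.
have ri : represented (ev i) by exists i.
by rewrite -ler_norml -(val_ev sp); apply: norm_val_le.
Qed.

Lemma closed_character : closed E.
Proof.
have -> : E = K `&` [set p : X | forall A, clop A -> prb p A = 0 \/ prb p A = 1].
  by apply/seteqP; split.
apply: closedI; first exact: closed_state.
apply: closed_forall => A; apply: closed_forall => _.
have ceq := closed_preimage (eval_continuous (idx \1_A)) (@closed_eq R _).
exact: (closedU (ceq 0) (ceq 1)).
Qed.

Lemma compact_character : compact E.
Proof. by apply: subclosed_compact closed_character compact_state _ => p []. Qed.

(** The Stone map: two-valued states act as ultrafilters, and [hat A] collects those containing
    [A]. *)
Definition hat (A : set S) : set X := [set p | character p /\ prb p A = 1].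

Lemma closed_hat A : closed (hat A).
Proof.
apply: closedI; first exact: closed_character.
exact: (closed_preimage (eval_continuous (idx \1_A)) (@closed_eq R 1)).
Qed.

Lemma compact_hat A : compact (hat A).
Proof. by apply: subclosed_compact (@closed_hat A) compact_character _ => p []. Qed.

Lemma hat_point A s : clop A -> hat A (point s) <-> A s.
Proof.
move=> cA; split=> [[_]|As].
  rewrite /prb val_point// indicE; have [/set_mem//|_ /eqP] := boolP (s \in A).
  by rewrite eq_sym oner_eq0.
by split; [exact: character_point|rewrite /prb val_point// indicE mem_set].
Qed.

(** Dirac states detect membership of points. *)
Lemma hat_subset A B : clop A -> clop B -> hat A `<=` hat B -> A `<=` B.
Proof. by move=> cA cB AB s /(hat_point _ cA)/AB/(hat_point _ cB). Qed.

Lemma hat0 : hat set0 = set0.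
Proof.
apply/seteqP; split=> // p [[sp _]]; rewrite (prb_set0 sp) => /eqP.
by rewrite eq_sym oner_eq0.
Qed.

Lemma hatT : hat setT = E.
Proof. by apply/seteqP; split=> p [] // sp p01; split=> //; exact: prb_setT. Qed.

Lemma hatU A B : clop A -> clop B -> hat (A `|` B) = hat A `|` hat B.
Proof.
move=> cA cB; apply/seteqP; split=> p; last first.
  have cAB := clopU cA cB.
  by case=> -[cp p1]; have [sp _] := cp; split=> //; apply/eqP;
    rewrite eq_le prb_le1//= -p1; apply: le_prb.
move=> [cp pAB]; have [sp p01] := cp.
have [pA0|pA1] := p01 _ cA; last by left.
have [pB0|pB1] := p01 _ cB; last by right.
have := prbI1 sp (clopC cA) (clopC cB).
rewrite !(prbC sp)// pA0 pB0 subr0 => /(_ erefl erefl); rewrite -setCU prbC//.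
  by rewrite pAB subrr => /eqP; rewrite eq_sym oner_eq0.
exact: clopU.
Qed.

Lemma hatI A B : clop A -> clop B -> hat (A `&` B) = hat A `&` hat B.
Proof.
move=> cA cB; apply/seteqP; split=> p; last first.
  by case=> -[cp pA] [_ pB]; split=> //; apply: prbI1 => //; case: cp.
have cAB := clopI cA cB.
move=> [cp p1]; have [sp _] := cp; split; split=> //; apply/eqP;
    by rewrite eq_le prb_le1//= -p1; apply: le_prb.
Qed.

Lemma hatC A : clop A -> hat (~` A) = E `\` hat A.
Proof.
move=> cA; apply/seteqP; split=> p.
  move=> [cp]; have [sp _] := cp; rewrite prbC// => pA; split=> // -[_ pA1].
  by move: pA; rewrite pA1 subrr => /eqP; rewrite eq_sym oner_eq0.
move=> [cp npA]; have [sp p01] := cp; split=> //; rewrite prbC//.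
by have [->|pA1] := p01 _ cA; [rewrite subr0|case: npA].
Qed.

Lemma map_eq_In (p q : I -> R) (F : seq I) i :
  List.In i F -> map p F = map q F -> p i = q i.
Proof. by elim: F => //= j F IH [->|iF] [pq pqF]; [|exact: IH]. Qed.

(** The cells of [p] and of [q] both have probability 1 under [p], so they share a point, whose
    values on [F] are those of [p] and of [q]. *)
Lemma hat_cell p q F : character p -> hat (cell q F) p -> map p F = map q F.
Proof.
move=> cp [_ pq]; have [sp _] := cp.
have := prbI1 sp (clop_cell p F) (clop_cell q F) (character_cell F cp) pq.
have [[s [<- <-]]//|n0] := pselect (cell p F `&` cell q F !=set0).
have -> : cell p F `&` cell q F = set0.
  by apply/seteqP; split=> // s sc; apply: n0; exists s.
by rewrite prb_set0// => /eqP; rewrite eq_sym oner_eq0.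
Qed.

Lemma hat_basis (q : X) (U : set X) : E q -> open U -> U q ->
  exists A, [/\ clop A, hat A q & hat A `<=` U].
Proof.
move=> Eq oU Uq; have [F [e [e0 FU]]] := nbhs_ptws (open_nbhs_nbhs (conj oU Uq)).
exists (cell q F); split; first exact: clop_cell.
  by split=> //; exact: character_cell.
move=> r hr; apply: FU => i iF; have [cr _] := hr.
by rewrite (map_eq_In iF (hat_cell cr hr)) subrr normr0.
Qed.

(** By compactness finitely many basic sets inside [U] cover [C]; their union is again of the form
    [hat A]. *)
Lemma hat_between (C U : set X) : compact C -> C `<=` E -> open U -> C `<=` U ->
  exists A, [/\ clop A, C `<=` hat A & hat A `<=` U].
Proof.
move=> cC CE oU CU; have : @cover_compact X C by rewrite -(@compact_cover X).
(* The cover must be open in [X]. The threshold [1 / 2] gives open sets whose trace on [E] is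
   [hat A]. *)
move=> /(_ _ [set A | clop A /\ hat A `<=` U] (fun A => [set p : X | 1 / 2 < prb p A])).
case=> [A _||D DP CD].
- exact: (open_preimage (eval_continuous (idx \1_A)) (@open_gt R (1 / 2))).
- move=> q Cq; have [A [cA [_ qA] AU]] := hat_basis (CE _ Cq) oU (CU _ Cq).
  by exists A => //=; rewrite qA; lra.
suff [B [cB BU DB]] : exists B, [/\ clop B, hat B `<=` U &
    forall A, A \in (finmap.enum_fset D) -> A `<=` B].
  exists B; split=> // q Cq; have [A /= AD qA] := CD _ Cq.
  have /set_mem[cA _] := DP _ AD; have [sq q01] := CE _ Cq.
  split; first exact: CE.
  have := le_prb sq cA cB (DB _ AD); have [->|//] := q01 _ cB.
  by move: qA => /=; lra.
have : forall A, A \in finmap.enum_fset D -> clop A /\ hat A `<=` U.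
  by move=> A AD; have /set_mem := DP _ AD.
elim: (finmap.enum_fset D) => [_|A l IH Al].
  by exists set0; split=> //; [exact: clop_set0|rewrite hat0].
have [|B [cB BU lB]] := IH; first by move=> A' A'l; apply: Al; rewrite inE A'l orbT.
have [|cA AU] := Al A; first by rewrite inE eqxx.
exists (A `|` B); split; first exact: clopU.
  by rewrite hatU// subUset.
move=> A'; rewrite inE => /predU1P[->|/lB A'B]; first exact: subsetUl.
by apply: subset_trans A'B _; exact: subsetUr.
Qed.

(** * Caratheodory construction of the representing measure *)

Section RepresentingMeasure.
Variable p : I -> R.
Hypothesis stp : state p.
Local Open Scope ereal_scope.

Definition content (U : set X) : \bar R :=
  ereal_sup [set (prb p A)%:E | A in [set A | clop A /\ hat A `<=` U]].

Definition outer (B : set X) : \bar R :=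
  ereal_inf [set content U | U in [set U : set X | open U /\ B `<=` U]].

Lemma prb_le_content A U : clop A -> hat A `<=` U -> (prb p A)%:E <= content U.
Proof. by move=> cA AU; apply: ereal_sup_ubound; exists A. Qed.

Lemma content_ge0 U : 0 <= content U.
Proof.
have -> : 0 = (prb p set0)%:E by rewrite prb_set0.
by apply: prb_le_content; [exact: clop_set0|rewrite hat0].
Qed.

Lemma content_le1 U : content U <= 1.
Proof. by apply: ge_ereal_sup => _ [A [cA _] <-]; rewrite lee_fin; exact: prb_le1. Qed.

Lemma le_content U V : U `<=` V -> content U <= content V.
Proof.
move=> UV; apply: ge_ereal_sup => _ [A [cA AU] <-]; apply: prb_le_content => //.
exact: subset_trans UV.
Qed.

Lemma content_set0 : content set0 = 0.
Proof.
apply/eqP; rewrite eq_le content_ge0 andbT; apply: ge_ereal_sup => _ [A [cA A0] <-].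
have -> : A = set0.
  by apply/seteqP; split=> //; apply: hat_subset => //; rewrite ?hat0//; exact: clop_set0.
by rewrite prb_set0.
Qed.

Lemma content_character U : E `<=` U -> content U = 1.
Proof.
move=> EU; apply/eqP; rewrite eq_le content_le1/= -[X in X%:E <= _](prb_setT stp).
by apply: prb_le_content; [exact: clop_setT|rewrite hatT].
Qed.

(** If [hat A] lies in the union, [hat_between] puts a clopen [hat B] between the compact set of
    points of [hat A] outside [V] and the open set [U]. Then [A] splits into a part inside [U] and a
    part inside [V]. *)
Lemma contentU (U V : set X) : open U -> open V ->
  content (U `|` V) <= content U + content V.
Proof.
move=> oU oV; apply: ge_ereal_sup => _ [A [cA AUV] <-].
have [||||B [cB AB BU]] := @hat_between (hat A `&` ~` V) U.
- apply: subclosed_compact _ (@compact_hat A) _ => [|q []//].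
  by apply: closedI; [exact: closed_hat|exact: open_closedC].
- by move=> q [[]].
- by [].
- by move=> q [/AUV[]].
rewrite (prbD stp cA cB) EFinD; apply: leeD; apply: prb_le_content.
- exact: clopI.
- by rewrite hatI// => q [_ /BU].
- exact: clopD.
- rewrite setDE hatI//; last exact: clopC.
  rewrite hatC// => q [qA [_ qB]]; apply: contrapT => qV.
  by apply: qB; apply: AB.
Qed.

Lemma content_bigsetU (U : (set X)^nat) n : (forall i, open (U i)) ->
  open (\big[setU/set0]_(i < n) U i) /\
  content (\big[setU/set0]_(i < n) U i) <= \sum_(i < n) content (U i).
Proof.
move=> oU; elim: n => [|n [IHo IH]].
  by rewrite !big_ord0 content_set0; split=> //; exact: open0.
rewrite !big_ord_recr/=; split; first exact: openU.
by rewrite (le_trans (contentU _ _))// leeD.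
Qed.

Lemma content_bigcup (U : (set X)^nat) : (forall i, open (U i)) ->
  content (\bigcup_i U i) <= \sum_(i <oo) content (U i).
Proof.
move=> oU; apply: ge_ereal_sup => _ [A [cA AU] <-].
have : @cover_compact X (hat A) by rewrite -(@compact_cover X); exact: compact_hat.
move=> /(_ nat setT U)[//|q /AU[i _ Ui]|D _ AD]; first by exists i.
(* The successor is needed because the union runs over indices strictly below [N]. *)
pose N := (\max_(i <- finmap.enum_fset D) i).+1.
have AN : hat A `<=` \big[setU/set0]_(i < N) U i.
  move=> q /AD[i /= iD Ui]; rewrite -bigcup_mkord; exists i => //=.
  by rewrite /N ltnS; apply: leq_bigmax_seq.
apply: (le_trans (prb_le_content cA AN)).
apply: (le_trans (content_bigsetU N oU).2).
rewrite -(big_mkord xpredT (content \o U)).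
by apply: nneseries_lim_ge => i _ _; exact: content_ge0.
Qed.

Lemma outer_le_content (B U : set X) : open U -> B `<=` U -> outer B <= content U.
Proof. by move=> oU BU; apply: ereal_inf_lbound; exists U. Qed.

Lemma outer_open (U : set X) : open U -> outer U = content U.
Proof.
move=> oU; apply/eqP; rewrite eq_le outer_le_content//=.
by apply: le_ereal_inf_tmp => _ [V [_ UV] <-]; exact: le_content.
Qed.

Lemma outer_ge0 B : 0 <= outer B.
Proof. by apply: le_ereal_inf_tmp => _ [V _ <-]; exact: content_ge0. Qed.

Lemma outer_le1 B : outer B <= 1.
Proof.
by apply: (le_trans (@outer_le_content B setT openT _)) => //; exact: content_le1.
Qed.

Lemma outer_fin_num B : outer B \is a fin_num.
Proof.
by rewrite ge0_fin_numE ?outer_ge0//; apply: le_lt_trans (outer_le1 B) _; rewrite ltry.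
Qed.

Lemma outer_set0 : outer set0 = 0.
Proof. by rewrite outer_open ?content_set0//; exact: open0. Qed.

Lemma le_outer : {homo outer : A B / A `<=` B >-> A <= B}.
Proof.
move=> A B AB; apply: le_ereal_inf_tmp => _ [V [oV BV] <-].
by apply: outer_le_content => //; exact: subset_trans BV.
Qed.

Lemma outer_sigma_subadditive : sigma_subadditive outer.
Proof.
move=> F; apply/lee_addgt0Pr => e e0.
apply: le_trans _ (epsilon_trick _ (fun n => outer_ge0 (F n)) (ltW e0)).
have /choice[U UP] : forall n, exists U : set X, [/\ open U, F n `<=` U &
    content U <= outer (F n) + (e / (2 ^ n.+1)%:R)%:E].
  move=> n; have en0 : (0 < e / (2 ^ n.+1)%:R)%R by rewrite divr_gt0// ltr0n expn_gt0.
  have [_ [U [oU FU] <-] /ltW UF] := lb_ereal_inf_adherent en0 (outer_fin_num (F n)).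
  by exists U.
apply: (@le_trans _ _ (content (\bigcup_n U n))).
  apply: outer_le_content; first by apply: bigcup_open => n _; have [] := UP n.
  by move=> q [n _ Fq]; exists n => //; have [_ FU _] := UP n; exact: FU.
apply: (le_trans (content_bigcup _)); first by move=> n; have [] := UP n.
by apply: lee_nneseries => n _ *; [exact: content_ge0|have [] := UP n].
Qed.

HB.instance Definition _ := isOuterMeasure.Build R X outer
  outer_set0 outer_ge0 le_outer outer_sigma_subadditive.

(** The test set is enlarged to an open [V]. A clopen [hat A] approximates the part of [V] in [U]
    from inside, and a clopen [hat B] the open set of points of [V] outside [hat A]. They are
    disjoint, so additivity of [prb] bounds the sum by the content of [V]. *)
Lemma caratheodory_open (U : set X) : open U -> outer.-caratheodory U.
Proof.
move=> oU; apply: le_caratheodory_measurable => Y.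
apply: le_ereal_inf_tmp => _ [V [oV YV] <-].
apply: (@le_trans _ _ (content (V `&` U) + outer (V `&` ~` U))).
  apply: leeD; last by apply: le_outer; exact: setSI.
  by apply: outer_le_content; [exact: openI|exact: setSI].
rewrite -leeBrDr ?outer_fin_num//; apply: ge_ereal_sup => _ [A [cA AVU] <-].
rewrite leeBrDr ?outer_fin_num//.
apply: (@le_trans _ _ ((prb p A)%:E + content (V `&` ~` hat A))).
  apply: leeD2l; apply: outer_le_content.
    by apply: openI => //; apply: closed_openC; exact: closed_hat.
  by apply: setIS; apply: subsetC => q /AVU[].
rewrite -leeBrDl//; apply: ge_ereal_sup => _ [B [cB BV] <-].
rewrite leeBrDl// -EFinD -prbU//.
  apply: prb_le_content; first exact: clopU.
  by rewrite hatU// => q [/AVU[]|/BV[]].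
apply/seteqP; split=> //; apply: hat_subset.
- exact: clopI.
- exact: clop_set0.
- by rewrite hat0 hatI// => q [qA /BV[_]].
Qed.

Lemma caratheodory_borel (B : set (borelX R I)) :
  measurable B -> outer.-caratheodory B.
Proof.
apply: smallest_sub; last exact: caratheodory_open.
exact: (@sigma_algebra_measurable _ (caratheodory_type (outer : {outer_measure set X -> \bar R}))).
Qed.

Definition repr_measure : set (borelX R I) -> \bar R := outer.

Let repr_measure0 : repr_measure set0 = 0.
Proof. exact: outer_set0. Qed.

Let repr_measure_ge0 B : 0 <= repr_measure B.
Proof. exact: outer_ge0. Qed.

Let repr_measure_sigma_additive : semi_sigma_additive repr_measure.
Proof.
move=> F mF tF mUF.
apply: (@caratheodory_measure_sigma_additive R X (outer : {outer_measure set X -> \bar R})) => //.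
- by move=> i; exact: caratheodory_borel.
- exact: caratheodory_borel.
Qed.

HB.instance Definition _ := isMeasure.Build _ (borelX R I) R repr_measure
  repr_measure0 repr_measure_ge0 repr_measure_sigma_additive.

Let repr_measure_setT : repr_measure setT = 1.
Proof. by rewrite /repr_measure outer_open ?content_character//; exact: openT. Qed.

HB.instance Definition _ := Measure_isProbability.Build _ (borelX R I) R repr_measure
  repr_measure_setT.

Definition repr_probability : probability (borelX R I) R := repr_measure.

End RepresentingMeasure.

(** * Uniform approximation of continuous affine functions by coordinates *)

Lemma continuous_determined (h : X -> R) (e : R) : {within K, continuous h} -> 0 < e ->
  exists F : seq I, forall q r : X, K q -> K r -> map q F = map r F -> `|h q - h r| <= e.
Proof.
move=> /subspace_continuousP hc e0; have e20 : 0 < e / 2 by rewrite divr_gt0.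
(* The condition bears on all states agreeing with [r] on [F], so two states that agree there are
   both close to [h q]. *)
pose near_h (q : X) (F : seq I) : set X := [set r : X | forall r' : X, map r' F = map r F -> K r' ->
   `|h r' - h q| < e / 2].
have /choice[F FP] : forall q : X, exists F : seq I, K q -> nbhs q (near_h q F).
  move=> q; have [Kq|] := pselect (K q); last by exists [::].
  have /cvgrPdist_lt/(_ _ e20) hq := hc q Kq.
  have [F [d [d0 FP]]] := nbhs_ptws hq.
  exists F => _.
  apply: filterS (_ : nbhs q [set r : X | forall i, List.In i F -> `|r i - q i| < d]).
    move=> r rP r' rr' Kr'; rewrite distrC; apply: FP => // i iF.
    by rewrite (map_eq_In iF rr'); exact: rP.
  elim: {FP} F => [|i F IH]; first by apply: filterS (filterT : nbhs q setT) => r _ i.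
  have /cvgrPdist_lt/(_ _ d0) qi := eval_continuous i q.
  apply: filterS (filterI qi IH) => r [ri rF] j [<-|/rF//].
  by rewrite distrC.
have : @cover_compact X K by rewrite -(@compact_cover X); exact: compact_state.
move=> /(_ _ K (fun q => (near_h q (F q))°))[q _|q Kq|D DK KD].
- exact: open_interior.
- by exists q => //; rewrite /interior; exact: FP.
(* The coordinates of a finite subcover are put together, so agreement on them includes agreement on
   the list of each centre. *)
exists (flatten (map F (finmap.enum_fset D))) => q r Kq Kr qr.
have [q0 /= q0D /interior_subset q0q] := KD _ Kq.
have qrF : map r (F q0) = map q (F q0).
  have {}q0D : q0 \in finmap.enum_fset D := q0D.
  elim: (finmap.enum_fset D) q0D qr => [//|] q1 l IH; rewrite inE /= !map_cat.
  move=> q0l /eqP; rewrite eqseq_cat ?size_map// => /andP[/eqP E1 /eqP E2].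
  by case/predU1P: q0l => [->|/IH]; [rewrite E1|apply].
have h1 := q0q q erefl Kq; have h2 := q0q r qrF Kr.
have := ler_distD (h q0) (h q) (h r); rewrite (distrC (h q0)); lra.
Qed.

Lemma affine_combination (h : X -> R) (l : seq S) (w : S -> R) :
  affine_on K h -> (forall t, 0 <= w t) -> 0 < \sum_(t <- l) w t ->
  let q : X := fun i => (\sum_(t <- l) w t * ev i t) / \sum_(t <- l) w t in
  K q /\ h q = (\sum_(t <- l) w t * h (point t)) / \sum_(t <- l) w t.
Proof.
move=> ha w0; elim: l => [|t l IH]; first by rewrite big_nil ltxx.
rewrite big_cons => W0 q; have W'0 : 0 <= \sum_(j <- l) w j by rewrite sumr_ge0.
(* Affinity concerns two points, so the first one is split off the average. If the other weights
   vanish they cannot be normalised, and the average is a Dirac state. *)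
move: W'0; rewrite le_eqVlt => /predU1P[W'0|W'0].
  have wl (f : S -> R) : \sum_(j <- l) w j * f j = 0.
    elim: (l) W'0 => [|j l' IHl]; first by move=> _; rewrite big_nil.
    rewrite !big_cons => /esym/eqP; rewrite paddr_eq0 ?sumr_ge0//.
    by move=> /andP[/eqP -> /eqP/esym/IHl ->]; rewrite mul0r addr0.
  have wt0 : w t != 0 by move: W0; rewrite -W'0 addr0 => /gt_eqF ->.
  have -> : q = point t.
    apply/funext => i; rewrite /q !big_cons wl -W'0 !addr0 mulrC mulrA mulVf//.
    by rewrite mul1r.
  split; first exact: state_point.
  by rewrite big_cons wl -W'0 !addr0 mulrC mulrA mulVf// mul1r.
have [Kq' hq'] := IH W'0.
set q' : X := fun i => _ in Kq' hq'.
set W := w t + \sum_(j <- l) w j in W0 *.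
have WN : W != 0 by rewrite gt_eqF.
have W'N : \sum_(j <- l) w j != 0 by rewrite gt_eqF.
have t01 : 0 <= w t / W <= 1.
  by rewrite divr_ge0 ?(ltW W0)//= ler_pdivrMr// mul1r /W lerDl ltW.
have E1 : 1 - w t / W = (\sum_(j <- l) w j) / W.
  by rewrite -[X in X - _](divff WN) -mulrBl /W addrC addKr.
have -> : q = cvx (w t / W) (point t) q'.
  apply/funext => i; rewrite /q /cvx E1 /q' big_cons /point.
  by rewrite -/W; field; exact/andP.
split; first by apply: state_cvx => //; exact: state_point.
rewrite ha//; last exact: state_point.
by rewrite E1 hq' big_cons; field; exact/andP.
Qed.

(* [h] is replaced by its weighted average over the cells of a finite set of
   coordinates that determines [h] up to [e]. *)
Lemma affine_approx (h : X -> R) (e : R) : {within K, continuous h} -> affine_on K h ->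
  0 < e -> exists k : I, forall q, K q -> `|h q - q k| <= e.
Proof.
move=> hc ha e0; have [F hF] := continuous_determined hc e0.
have [l lP] := cell_partition F.
pose ind t : S -> R := \1_(cell (point t) F).
have rind t : represented (ind t) by exact: clop_cell.
exists (idx (fun s => \sum_(t <- l) h (point t) * ind t s)) => q Kq.
have -> : q (idx (fun s => \sum_(t <- l) h (point t) * ind t s)) =
    \sum_(t <- l) val q (ind t) * h (point t).
  rewrite -[LHS]/(val q _) (val_sum Kq _ (f := fun t s => h (point t) * ind t s)); last first.
    by move=> t; apply: reprZ.
  by apply: eq_bigr => t _; rewrite (valZ Kq)// mulrC.
have W1 : \sum_(t <- l) val q (ind t) = 1.
  by rewrite -(val_sum Kq)// -(val1 Kq); congr val; apply/funext.
have w0 t : 0 <= val q (ind t) by apply: (prb_ge0 Kq); exact: clop_cell.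
have [|Kq' hq'] := @affine_combination h l (fun t => val q (ind t)) ha w0.
  by rewrite W1.
move: Kq' hq'; set q' := (fun i => _ : R).
rewrite W1 divr1 => Kq' <-; apply: hF => //.
(* For [i] in [F] the function [ev i] is constant on each cell, so averaging over the cells does not
   change its value. *)
suff H i : List.In i F -> q i = q' i.
  elim: (F) H => [//|i G IH H] /=; rewrite (H i (or_introl erefl)).
  by rewrite IH// => j jG; apply: H; right.
move=> iF; have ri : represented (ev i) by exists i.
rewrite /q' W1 divr1 -(val_ev Kq).
have evE : ev i = (fun s => \sum_(t <- l) ev i t * ind t s).
  apply/funext => s; rewrite -[LHS]mulr1 -(lP s) mulr_sumr; apply: eq_bigr => t _.
  rewrite /ind indicE; have [sc|_] := boolP (s \in cell (point t) F).
    have -> // : ev i s = ev i t.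
    by have /set_mem := sc; exact: map_eq_In.
  by rewrite !mulr0.
rewrite [in LHS]evE (val_sum Kq _ (f := fun t s => ev i t * ind t s)) => [|t]; last exact: reprZ.
by apply: eq_bigr => t _; rewrite (valZ Kq)// mulrC.
Qed.

(** * Measurability, integrals and barycenters *)

Lemma measurable_closed (C : set X) : closed C -> measurable (C : set (borelX R I)).
Proof.
move=> cC; rewrite -(setCK C); apply: measurableC; apply: sub_sigma_algebra.
exact: closed_openC.
Qed.

Lemma measurable_open (U : set X) : open U -> measurable (U : set (borelX R I)).
Proof. exact: sub_sigma_algebra. Qed.

Lemma measurable_eval i (D : set (borelX R I)) :
  measurable_fun D (fun q : borelX R I => q i).
Proof.
apply: (@measurable_funS _ _ _ _ setT) => //.
apply: (measurability _ (RGenOpens.measurableE R)) => _ [_ [a [b ->] <-]].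
rewrite setTI; apply: measurable_open.
by apply: open_preimage; [exact: eval_continuous|exact: interval_open].
Qed.

Section Means.
Variable nu : probability (borelX R I) R.
Hypothesis nuE : nu (E : set (borelX R I)) = 1%E.

Let mK : measurable (K : set (borelX R I)).
Proof. by apply: measurable_closed; exact: closed_state. Qed.

Let mE : measurable (E : set (borelX R I)).
Proof. by apply: measurable_closed; exact: closed_character. Qed.

Let mhat A : measurable (hat A : set (borelX R I)).
Proof. by apply: measurable_closed; exact: closed_hat. Qed.

Lemma measure_state : nu (K : set (borelX R I)) = 1%E.
Proof.
apply/eqP; rewrite eq_le probability_le1//= -nuE.
by apply: le_measure; rewrite ?inE// => q [].
Qed.

Lemma measure_not_character : nu (~` E : set (borelX R I)) = 0%E.
Proof. by rewrite probability_setC// nuE subee. Qed.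

Let Rintegral_state_cst (r : R) :
  \int[nu]_(q in (K : set (borelX R I))) r = r.
Proof.
rewrite Rintegral_cst// -[RHS]mulr1; congr (_ * _).
exact: (congr1 fine measure_state).
Qed.

Lemma integrable_on_state (h : X -> R) M :
  measurable_fun (K : set (borelX R I)) h -> (forall q, K q -> `|h q| <= M) ->
  nu.-integrable K (EFin \o h).
Proof.
move=> mh hM; apply: measurable_bounded_integrable => //.
  by apply: le_lt_trans (probability_le1 nu mK) _; rewrite ltry.
exists M; split; first exact: num_real.
by move=> N /ltW MN q Kq; apply: le_trans (hM q Kq) MN.
Qed.

Lemma integrable_eval i : nu.-integrable K (EFin \o (fun q : borelX R I => q i)).
Proof.
have ri : represented (ev i) by exists i.
have [B _ fB] := repr_bounded ri.
apply: (@integrable_on_state _ B) => [|q sq]; first exact: measurable_eval.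
by rewrite -(val_ev sq); apply: norm_val_le.
Qed.

(** On [E] the integrand is the indicator of [hat A], and the complement of [E] is null. *)
Lemma integral_prb A : clop A ->
  (\int[nu]_(q in (K : set (borelX R I))) (prb q A)%:E = nu (hat A))%E.
Proof.
move=> cA.
have -> : nu (hat A) = (\int[nu]_(q in (K : set (borelX R I))) (\1_(hat A) q)%:E)%E.
  rewrite integral_indic//; congr (nu _); apply/seteqP; split=> [q|q []//].
  by move=> [cq qA]; split; [split|case: cq].
apply: ae_eq_integral => //.
- by apply/measurable_EFinP; exact: measurable_eval.
- by apply/measurable_EFinP; exact: measurable_indic.
exists (~` E); split; [exact: measurableC|exact: measure_not_character|].
move=> q /= nq cq; apply: nq => _; rewrite indicE.
have [sq [q0|q1]] := (cq.1, cq.2 _ cA).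
  by rewrite q0 memNset//= => -[_]; rewrite q0 => /eqP; rewrite eq_sym oner_eq0.
by rewrite q1 mem_set.
Qed.

Definition mean : X := fun i => \int[nu]_(q in (K : set (borelX R I))) q i.

Lemma state_mean : state mean.
Proof.
split; rewrite /mean.
- move=> i j k kE; rewrite -RintegralD//; [|exact: integrable_eval..].
  by apply: eq_Rintegral => q /set_mem[qD _ _ _]; exact: qD.
- move=> c i k kE; rewrite -RintegralZl//; last exact: integrable_eval.
  by apply: eq_Rintegral => q /set_mem[_ qZ _ _]; exact: qZ.
- by move=> i i0; apply: Rintegral_ge0 => q [_ _ q0 _]; exact: q0.
- move=> i iE; transitivity (\int[nu]_(q in (K : set (borelX R I))) (1 : R)).
    by apply: eq_Rintegral => q /set_mem[_ _ _ q1]; exact: q1.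
  exact: Rintegral_state_cst.
Qed.

(** For coordinates the formula is the definition of [mean]; uniform approximation on [K] extends it
    to every continuous affine [h]. *)
Lemma barycenter_mean : barycenter K nu mean.
Proof.
move=> h hc ha.
have appr e : 0 < e -> exists k, forall q, K q -> `|h q - q k| <= e.
  exact: affine_approx.
(* Measurability of [h] follows because it is a limit of coordinates. *)
have /choice[k kP] : forall n : nat, exists k, forall q, K q -> `|h q - q k| <= n.+1%:R^-1.
  by move=> n; apply: appr; rewrite invr_gt0.
have mh : measurable_fun (K : set (borelX R I)) h.
  apply: (@measurable_fun_cvg _ (borelX R I) R K (fun n (q : borelX R I) => q (k n)) h)
    => [n|q Kq].
    exact: measurable_eval.
  apply/cvgrPdist_le => e e0; near=> n; apply: (le_trans (kP n q Kq)).
  by apply/ltW; near: n; exact: near_infty_natSinv_lt (PosNum e0).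
have [k0 k0P] := appr 1 ltr01.
have ih : nu.-integrable K (EFin \o h).
  have rk : represented (ev k0) by exists k0.
  have [B _ fB] := repr_bounded rk.
  apply: (@integrable_on_state _ (1 + B)) => // q Kq.
  have := norm_val_le Kq rk fB; rewrite (val_ev Kq).
  have := ler_distD (q k0) (h q) 0; rewrite !subr0; have := k0P q Kq; lra.
rewrite -[RHS]fineK; last exact: integrable_fin_num.
congr EFin; rewrite -[RHS]/(\int[nu]_(q in (K : set (borelX R I))) h q).
apply/eqP; rewrite -subr_eq0 -normr_le0; apply/ler_addgt0Pr => e e0; rewrite add0r.
have e20 : 0 < e / 2 by rewrite divr_gt0.
have [i iP] := appr _ e20.
have := iP _ state_mean.
have : `|mean i - \int[nu]_(q in (K : set (borelX R I))) h q| <= e / 2.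
  rewrite /mean -RintegralB//; last exact: integrable_eval.
  have id : nu.-integrable K (EFin \o (fun q : borelX R I => q i - h q)).
    have := integrableB mK (integrable_eval i) ih; apply: eq_integrable => //.
  apply: (le_trans (le_normr_Rintegral _ id)) => //.
  apply: (@le_trans _ _ (\int[nu]_(q in (K : set (borelX R I))) (e / 2))).
    apply: le_Rintegral => //.
    - exact: integrable_abse id.
    - apply: (@integrable_on_state (cst (e / 2)) (e / 2)) => [|q _]; first exact: measurable_cst.
      by rewrite /cst/= gtr0_norm.
    - by move=> q Kq; rewrite distrC; exact: iP.
  by rewrite Rintegral_state_cst.
have := ler_distD (mean i) (h mean) (\int[nu]_(q in (K : set (borelX R I))) h q); lra.
Unshelve. all: by end_near. Qed.

(** The map [prb _ A] is a coordinate, hence an admissible test function. *)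
Lemma barycenter_hat p A : barycenter K nu p -> clop A -> nu (hat A) = (prb p A)%:E.
Proof.
move=> bp cA; rewrite -integral_prb//; symmetry; apply: bp => [|x y t _ _ _//].
by apply: continuous_subspaceT; exact: eval_continuous.
Qed.

Lemma mean_unique p : state p -> (forall A, clop A -> nu (hat A) = (prb p A)%:E) ->
  mean = p.
Proof.
move=> sp nup; apply: state_eq => //; first exact: state_mean.
move=> A cA; apply: EFin_inj; rewrite -nup//.
by rewrite (barycenter_hat barycenter_mean).
Qed.

End Means.

(** * Existence, regularity and uniqueness of the representing measure *)

Section Representation.
Variable p : I -> R.
Hypothesis stp : state p.
Local Open Scope ereal_scope.
Local Notation mu := (repr_probability stp).

Let mE : measurable (E : set (borelX R I)).
Proof. by apply: measurable_closed; exact: closed_character. Qed.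

Let mhat A : measurable (hat A : set (borelX R I)).
Proof. by apply: measurable_closed; exact: closed_hat. Qed.

Lemma repr_open (U : set X) : open U -> mu U = content p U.
Proof. exact: outer_open. Qed.

(** Every [hat A] lies in [E], so only the empty one fits into the open complement. *)
Lemma repr_not_character : mu (~` E) = 0.
Proof.
rewrite repr_open; last by apply: closed_openC; exact: closed_character.
apply/eqP; rewrite eq_le content_ge0// andbT; apply: ge_ereal_sup => _ [A [cA AE] <-].
have -> : A = set0.
  apply/seteqP; split=> //; apply: hat_subset => //; first exact: clop_set0.
  by move=> q qA; case: (AE q qA); case: qA.
by rewrite prb_set0.
Qed.

Lemma repr_character : mu E = 1.
Proof.
rewrite -[X in mu X]setCK probability_setC; last exact: measurableC.
by rewrite repr_not_character sube0.
Qed.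

Lemma prb_le_repr A : clop A -> (prb p A)%:E <= mu (hat A).
Proof.
move=> cA; apply: le_ereal_inf_tmp => _ [U [_ AU] <-].
exact: prb_le_content.
Qed.

(** The lower bounds for [A] and for its complement add up to 1, the total mass of [E], so both are
    equalities. *)
Lemma repr_hat A : clop A -> mu (hat A) = (prb p A)%:E.
Proof.
move=> cA; have cA' := clopC cA.
have fin B : measurable B -> mu B = (fine (mu B))%:E.
  by move=> mB; rewrite fineK//; exact: fin_num_measure.
have mut : mu (hat A) + mu (hat (~` A)) = 1.
  rewrite -measureU//; last by rewrite hatC// setDE setICA setICr setI0.
  by rewrite -hatU// setUv hatT; exact: repr_character.
have := prb_le_repr cA; have := prb_le_repr cA'; move: mut.
rewrite (fin _ (mhat A)) (fin _ (mhat (~` A))) prbC// -EFinD => -[].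
by rewrite !lee_fin => mut h1 h2; congr EFin; apply/eqP; rewrite eq_le h2 andbT; lra.
Qed.

Lemma repr_regular : regular_measure mu.
Proof.
move=> B mB; split; last first.
  congr ereal_inf; apply/seteqP; split=> _ [U [oU BU] <-]; exists U => //.
    exact: repr_open.
  exact/esym/repr_open.
have fin A : measurable A -> mu A = (fine (mu A))%:E.
  by move=> mA; rewrite fineK//; exact: fin_num_measure.
have cpt_measurable (C : set X) : compact C -> measurable (C : set (borelX R I)).
  move=> cC; apply: measurable_closed; apply: compact_closed => //.
  exact: ptws_hausdorff.
apply/eqP; rewrite eq_le; apply/andP; split; last first.
  apply: ge_ereal_sup => _ [C [cC CB] <-].
  by apply: le_measure; rewrite ?inE//; exact: cpt_measurable.
apply/lee_addgt0Pr => e e0.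
(* Outer regularity is the definition of [outer]. Applied to the complement of [B] it gives inner
   regularity: [E] minus [U] is a compact subset of [B] that misses at most mass [e]. *)
have [_ [U [oU BU] <-] Ue] := lb_ereal_inf_adherent e0 (outer_fin_num stp (~` B)).
have mU := measurable_open oU.
have mC : measurable (E `\` U : set (borelX R I)) by exact: measurableD.
have cC : compact (E `\` U : set X).
  apply: subclosed_compact _ compact_character _ => [|q []//].
  by rewrite setDE; apply: closedI; [exact: closed_character|exact: open_closedC].
apply: (@le_trans _ _ (mu (E `\` U) + e%:E)); last first.
  apply: leeD2r; apply: ereal_sup_ubound; exists (E `\` U) => //; split=> //.
  by move=> q [_ qU]; apply: contrapT => qB; apply: qU; exact: BU.
have h1 : 1 <= mu (E `\` U) + mu U.
  rewrite -[X in X <= _]repr_character; apply: le_trans (measureU2 _ mC mU).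
  apply: le_measure; rewrite ?inE//; first exact: measurableU.
  by move=> q qE; have [qU|qU] := pselect (U q); [right|left].
have h2 : mu U < mu (~` B) + e%:E by rewrite repr_open.
have h3 : mu (~` B) = 1 - mu B := probability_setC _ mB.
move: h1 h2 h3; rewrite (fin _ mB) (fin _ mC) (fin _ mU) (fin _ (measurableC mB)).
by rewrite -!EFinD !lee_fin lte_fin => h1 h2 [h3]; lra.
Qed.

Lemma repr_representing : representing K p mu.
Proof.
split; [exact: repr_regular|by rewrite extreme_points_state repr_character|].
have pE : mean mu = p.
  by apply: (mean_unique repr_character stp) => A; exact: repr_hat.
by have := barycenter_mean repr_character; rewrite pE.
Qed.

(** The barycenter formula fixes [nu] on the sets [hat A]. Inner regularity with [hat_between] then
    fixes it on open sets, and outer regularity on all Borel sets. *)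
Lemma representing_unique (nu : probability (borelX R I) R) :
  representing K p nu -> forall B, measurable B -> nu B = mu B.
Proof.
rewrite /representing extreme_points_state => -[reg nuE bary].
have nuhat A : clop A -> nu (hat A) = (prb p A)%:E by exact: barycenter_hat.
have nu_open (U : set X) : open U -> nu U = content p U.
  move=> oU; have mU := measurable_open oU.
  apply/eqP; rewrite eq_le; apply/andP; split; last first.
    apply: ge_ereal_sup => _ [A [cA AU] <-].
    by rewrite -nuhat//; apply: le_measure; rewrite ?inE.
  rewrite (reg _ mU).1; apply: ge_ereal_sup => _ [C [cC CU] <-].
  have clC : closed C by apply: compact_closed => //; exact: ptws_hausdorff.
  have mC := measurable_closed clC.
  have [||||A [cA CA AU]] := @hat_between (C `&` E) U.
  - apply: subclosed_compact _ cC _ => [|q []//].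
    by apply: closedI => //; exact: closed_character.
  - by move=> q [].
  - by [].
  - by move=> q [/CU].
  apply: le_trans (prb_le_content p cA AU); rewrite -nuhat//.
  apply: (@le_trans _ _ (nu (hat A `|` ~` E))).
    apply: le_measure; rewrite ?inE//.
      by apply: measurableU => //; exact: measurableC.
    by move=> q Cq; have [Eq|] := pselect (E q); [left; apply: CA|right].
  apply: (le_trans (measureU2 _ _ _)) => //; first exact: measurableC.
  by have := measure_not_character nuE => /= ->; rewrite adde0.
move=> B mB; rewrite (reg _ mB).2; congr ereal_inf.
by apply/seteqP; split=> _ [U [oU BU] <-]; exists U => //; rewrite nu_open.
Qed.

End Representation.

Lemma bauer_simplex_state : bauer_simplex K.
Proof.
split.
- exact: compact_state.
- by move=> x y t; exact: state_cvx.
- by rewrite extreme_points_state; exact: closed_character.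
move=> p stp; exists (repr_probability stp); split; first exact: repr_representing.
exact: representing_unique.
Qed.

End States.

(** * Type spaces as state spaces *)

Lemma type_space_state (R : realType) (L : language R) (T : theory L)
    (M : structure L) n : complete_theory T -> models M T ->
  type_space T n = state (@feval R L M n).
Proof.
(* Order and equivalence of formulas modulo [T] are read off in [M], so the axioms of a type concern
   only the functions defined in [M]. *)
move=> cT MT; have equiv phi psi : feval M phi = feval M psi -> T_equiv T phi psi.
  by move=> E; apply/(complete_equiv cT MT) => a; rewrite E.
apply/seteqP; split=> p.
  move=> [pE pD pZ p0 p1]; split.
  - by move=> phi psi chi E; rewrite -pD; apply/pE/equiv; rewrite E.
  - by move=> c phi chi E; rewrite -pZ; apply/pE/equiv; rewrite E.
  - by move=> phi phi0; apply: p0; apply/(complete_nonneg cT MT).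
  - by move=> phi E; rewrite -p1; apply/pE/equiv; rewrite E.
move=> [pD pZ p0 p1]; split.
- move=> phi psi /(complete_equiv cT MT) E; rewrite -[RHS]mul1r; apply: pZ.
  by apply/funext => a; rewrite mul1r.
- by move=> phi psi; exact: pD.
- by move=> c phi; exact: pZ.
- by move=> phi /(complete_nonneg cT MT); exact: p0.
- exact: p1.
Qed.

Theorem mainTheorem2 (R : realType) (L : language R) (T : theory L) :
  complete_theory T -> has_first_order_model T ->
  forall n : nat, (1 <= n)%N -> bauer_simplex (type_space T n).
Proof.
move=> cT [M [MT foM]] [//|n] _; rewrite (type_space_state n.+1 cT MT).
have reprE f : represented (@feval R L M n.+1) f <-> definable f.
  by split=> -[phi E]; exists phi; [rewrite E|exact/funext].
apply: (bauer_simplex_state (fun=> s_point M)).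
- by apply/reprE; exact: definable_cst.
- by move=> f g /reprE df /reprE dg; apply/reprE; exact: definableD.
- by move=> c f /reprE df; apply/reprE; exact: definableZ.
- by move=> f g /reprE df /reprE dg; apply/reprE; exact: definable_maxr.
- by move=> f /reprE df; exact: (definable_finite foM df).
Qed.
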